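(* Let $E\to M$ be an oriented real vector bundle of rank $k$ with a Riemannian structure over a connected $d$-manifold $M$, let $n\ge k$, and let $\sigma:M\to\mathcal{F}^n(E)$ be a section. Suppose that $E\to M$ has non-trivial Euler class and that $H_1(M,\mathbb{Z}/2\mathbb{Z})=0$. Then $\sigma$ is not $i$-generic for any $1\leq i\leq k$.
   Context: A Riemannian structure on $E\to M$ is a choice of inner product on each fiber $E_p$, varying smoothly in $p$. For a $k$-dimensional real inner product space $V$ and $n\ge k$, $\mathcal{F}^n(V)$ is the space of surjective linear maps $\mathbb{R}^n\to V$ ($n$-frames). The $n$-frame bundle $\mathcal{F}^n(E)\to M$ is the fiber subbundle of $\operatorname{Hom}(M\times\mathbb{R}^n,E)$ with fiber $\mathcal{F}^n(E_p)$ over $p\in M$; a section of it corresponds to $n$ sections of $E$ that span $E_p$ at each $p$. Sections are smooth and manifolds are smooth. For $A\in\mathcal{F}^n(V)$, the frame operator $AA^T\in\operatorname{End}(V)$ ($A^T$ the adjoint with respect to the standard inner product on $\mathbb{R}^n$ and the inner product on $V$) is symmetric positive definite; let $\lambda_1\ge\lambda_2\ge\cdots\ge\lambda_k>0$ be its eigenvalues with multiplicity, and let $\mu_i(A)=|\{j:\lambda_j=\lambda_i\}|$ be the multiplicity of the $i$th eigenvalue. A section $\sigma:M\to\mathcal{F}^n(E)$ is $i$-generic if $\mu_i(\sigma(p))=1$ for all $p\in M$. *)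

(* Defs.v *)
From HB Require Import structures.
From mathcomp Require Import all_boot all_order all_algebra.
From mathcomp Require Import all_classical all_reals all_analysis.

Set Implicit Arguments.
Unset Strict Implicit.
Unset Printing Implicit Defensive.

Import Order.TTheory GRing.Theory Num.Theory.
Import numFieldNormedType.Exports.

Local Open Scope classical_set_scope.
Local Open Scope ring_scope.

(** * Smooth functions and manifolds *)

Section Smooth.
Context {R : realType} {d : nat}.

(* The directional derivative ['D_v f] is a total function; at the points of an
   open set [U] it only depends on the values of [f] on [U].  These definitions
   are meant for open [U]. *)
Fixpoint Cr_on (r : nat) (U : set 'rV[R]_d) (f : 'rV[R]_d -> R) : Prop :=
  {within U, continuous f} /\
  match r with
  | 0 => True
  | r'.+1 => forall v : 'rV[R]_d,
      (forall x, U x -> derivable f x v) /\ Cr_on r' U ('D_v f)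
  end.

Definition smooth_on (U : set 'rV[R]_d) (f : 'rV[R]_d -> R) : Prop :=
  forall r, Cr_on r U f.

End Smooth.

Section Manifold.
Context {R : realType} {d : nat}.

(* Only the values of [chart_map] on [chart_dom], and of [chart_inv] on the
   image of [chart_dom], are relevant. *)
Record chart (M : topologicalType) := Chart {
  chart_dom : set M;
  chart_map : M -> 'rV[R]_d;
  chart_inv : 'rV[R]_d -> M }.

Definition is_chart (M : topologicalType) (c : chart M) : Prop :=
  [/\ open (chart_dom c),
      open (chart_map c @` chart_dom c),
      {in chart_dom c, cancel (chart_map c) (chart_inv c)},
      {within chart_dom c, continuous (chart_map c)} &
      {within chart_map c @` chart_dom c, continuous (chart_inv c)}].

Definition compatible (M : topologicalType) (c c' : chart M) : Prop :=
  forall j : 'I_d,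
    smooth_on (chart_map c @` (chart_dom c `&` chart_dom c'))
              (fun x => chart_map c' (chart_inv c x) 0 j).

End Manifold.
Arguments chart : clear implicits.

Record manifold (R : realType) (d : nat) := Manifold {
  manifold_top :> topologicalType;
  manifold_hausdorff : hausdorff_space manifold_top;
  manifold_second_countable : @second_countable manifold_top;
  atlas : set (chart R d manifold_top);
  atlas_chart : forall c, atlas c -> is_chart c;
  atlas_cover : forall p, exists2 c, atlas c & chart_dom c p;
  atlas_compatible : forall c c', atlas c -> atlas c' -> compatible c c' }.

(* Smoothness on an open subset [U] of a manifold. *)
Definition smooth_fun (R : realType) (d : nat) (M : manifold R d)
    (U : set M) (f : M -> R) : Prop :=
  forall c, atlas c ->
    smooth_on (chart_map c @` (U `&` chart_dom c)) (f \o chart_inv c).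

(** * Smooth vector bundles *)

(* A point of the total space: a base point and a vector of the fibre over it.
   The type [{p & F p}] is avoided because it carries the disjoint union
   topology. *)
Record total_point (R : realType) (M : Type) (F : M -> vectType R) :=
  Total { base : M; vec : F base }.
Arguments Total {R M F} base vec.

(* Data of a vector bundle: its fibres and the topology of its total space. *)
Record bundle_data (R : realType) (M : Type) := BundleData {
  fibre :> M -> vectType R;
  bundle_topology : Topological.axioms_ (total_point fibre) }.

Definition total (R : realType) (M : Type) (E : bundle_data R M) :
  topologicalType := Topological.Pack (bundle_topology E).

Definition proj (R : realType) (M : Type) (E : bundle_data R M) (e : total E) :
  M := base e.

(* The fibrewise linear maps of a local trivialization [dom * R^k -> E]. *)
Record trivialization (R : realType) (k : nat) (M : Type)
    (E : bundle_data R M) := Trivialization {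
  triv_dom : set M;
  triv_map : forall p, 'Hom('rV[R]_k, E p) }.

Definition triv_frame (R : realType) (k : nat) (M : Type)
    (E : bundle_data R M) (t : trivialization k E) (p : M) : k.-tuple (E p) :=
  [tuple triv_map t p (delta_mx 0 a) | a < k].

(* Linear on the fibres, and a homeomorphism from [dom * R^k] to the inverse
   image of [dom]. *)
Definition is_trivialization (R : realType) (k : nat) (M : topologicalType)
    (E : bundle_data R M) (t : trivialization k E) : Prop :=
  [/\ open (triv_dom t),
      forall p, triv_dom t p ->
        lker (triv_map t p) = 0%VS /\ limg (triv_map t p) = fullv,
      {within triv_dom t `*` [set: 'rV[R]_k], continuous
         (fun z : M * 'rV[R]_k => Total z.1 (triv_map t z.1 z.2) : total E)} &
      {within @proj R M E @^-1` triv_dom t, continuous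
         (fun e : total E => (triv_map t (base e))^-1%VF (vec e) : 'rV[R]_k)}].

Definition smooth_transition (R : realType) (d k : nat) (M : manifold R d)
    (E : bundle_data R M) (t t' : trivialization k E) : Prop :=
  forall a b : 'I_k, smooth_fun (triv_dom t `&` triv_dom t')
    (fun p => (triv_map t' p)^-1%VF (tnth (triv_frame t p) a) 0 b).

Record vector_bundle (R : realType) (d : nat) (M : manifold R d) (k : nat) :=
  VectorBundle {
  bundle :> bundle_data R M;
  bundle_proj_cont : continuous (@proj R M bundle);
  bundle_atlas : set (trivialization k bundle);
  bundle_atlas_triv : forall t, bundle_atlas t -> is_trivialization t;
  bundle_atlas_cover : forall p, exists2 t, bundle_atlas t & triv_dom t p;
  bundle_atlas_smooth : forall t t', bundle_atlas t -> bundle_atlas t' ->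
    smooth_transition t t' }.
Arguments bundle_atlas {R d M k} E : rename.

(* An orientation of a vector space: a class of ordered bases whose change of
   basis matrices have positive determinant. *)
Definition is_orientation (R : realType) (k : nat) (V : vectType R)
    (o : set (k.-tuple V)) : Prop :=
  exists2 b : k.-tuple V, basis_of fullv b &
    o = [set b' : k.-tuple V | basis_of fullv b' /\
          0 < \det (\matrix_(i < k, j < k) coord b j (tnth b' i))].

(* An orientation of every fibre, locally constant in the trivializations. *)
Definition bundle_orientation (R : realType) (d k : nat) (M : manifold R d)
    (E : vector_bundle M k) (o : forall p, set (k.-tuple (E p))) : Prop :=
  (forall p, is_orientation (o p)) /\
  forall t p, bundle_atlas E t -> triv_dom t p ->
    \forall q \near p, o q (triv_frame t q) <-> o p (triv_frame t p).

Definition inner_product (R : realType) (V : vectType R) (g : V -> V -> R) :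
    Prop :=
  [/\ forall u v, g u v = g v u,
      forall a u v w, g (a *: u + v) w = a * g u w + g v w &
      forall u, u != 0 -> 0 < g u u].

Definition riemannian_structure (R : realType) (d k : nat) (M : manifold R d)
    (E : vector_bundle M k) (g : forall p, E p -> E p -> R) : Prop :=
  (forall p, inner_product (g p)) /\
  forall t, bundle_atlas E t -> forall a b : 'I_k, smooth_fun (triv_dom t)
    (fun p => g p (tnth (triv_frame t p) a) (tnth (triv_frame t p) b)).

(** * Frames and frame operators *)

(* The smooth sections of the n-frame bundle. *)
Definition frame_section (R : realType) (d k n : nat) (M : manifold R d)
    (E : vector_bundle M k) (sigma : forall p, 'Hom('rV[R]_n, E p)) : Prop :=
  (forall p, limg (sigma p) = fullv) /\
  forall t, bundle_atlas E t -> forall (j : 'I_n) (a : 'I_k),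
    smooth_fun (triv_dom t)
      (fun p => (triv_map t p)^-1%VF (sigma p (delta_mx 0 j)) 0 a).

(* The adjoint of [A] for the standard inner product of [R^n] and the inner
   product [g]: see [adjointP]. *)
Definition adjoint (R : realType) (n : nat) (V : vectType R) (g : V -> V -> R)
    (A : 'Hom('rV[R]_n, V)) : 'Hom(V, 'rV[R]_n) :=
  linfun (fun v => \row_(j < n) g (A (delta_mx 0 j)) v).

Lemma adjointP (R : realType) (n : nat) (V : vectType R) (g : V -> V -> R)
    (A : 'Hom('rV[R]_n, V)) (x : 'rV[R]_n) (v : V) :
  inner_product g -> \sum_(j < n) x 0 j * adjoint g A v 0 j = g (A x) v.
Proof.
move=> [gC gl _].
have gr u : linear (g u : V -> R^o).
  by move=> a y z; rewrite gC gl [g y u]gC [g z u]gC.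
pose f v : 'rV[R]_n := \row_(j < n) g (A (delta_mx 0 j)) v.
have flin : linear f by move=> a y z; apply/rowP => j; rewrite !mxE gr.
pose F : {linear V -> 'rV[R]_n} := HB.pack f (GRing.isLinear.Build _ _ _ _ f flin).
rewrite /adjoint -[linfun _]/(linfun F).
under eq_bigr do rewrite lfunE /= mxE.
pose h : V -> R^o := g^~ v.
have hlin : linear h by move=> a y z; rewrite /h gl.
pose H : {linear V -> R^o} := HB.pack h (GRing.isLinear.Build _ _ _ _ h hlin).
rewrite -[RHS]/(H (A x)) {2}[x]row_sum_delta !linear_sum.
by apply: eq_bigr => j _; rewrite !linearZ.
Qed.

Definition frame_operator (R : realType) (n : nat) (V : vectType R)
    (g : V -> V -> R) (A : 'Hom('rV[R]_n, V)) : 'End(V) :=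
  (A \o adjoint g A)%VF.

(* [lam] lists the eigenvalues of [f] with multiplicity, in nonincreasing
   order; the characteristic polynomial is computed in any basis. *)
Definition eigenvalues (R : realType) (k : nat) (V : vectType R) (f : 'End(V))
    (lam : 'I_k -> R) : Prop :=
  (forall i j : 'I_k, (i <= j)%N -> lam j <= lam i) /\
  char_poly (passmx.mxof (vbasis fullv) (vbasis fullv) f) =
    \prod_(j < k) ('X - (lam j)%:P).

Definition multiplicity (R : realType) (k : nat) (lam : 'I_k -> R) (i : 'I_k) :
  nat := #|[set j : 'I_k | lam j == lam i]|.

(* The nonincreasing list [lam] of the eigenvalues is unique, as it is determined
   by the characteristic polynomial. *)
Definition i_generic (R : realType) (d k n : nat) (M : manifold R d)
    (E : vector_bundle M k) (g : forall p, E p -> E p -> R)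
    (sigma : forall p, 'Hom('rV[R]_n, E p)) (i : 'I_k) : Prop :=
  forall p, exists lam : 'I_k -> R,
    eigenvalues (frame_operator (g p) (sigma p)) lam /\
    multiplicity lam i = 1%N.

(** * Singular homology and cohomology *)

Definition std_simplex (R : realType) (n : nat) : set 'rV[R]_n.+1 :=
  [set x | (forall j, 0 <= x 0 j) /\ \sum_j x 0 j = 1].
Arguments std_simplex : clear implicits.

Section Faces.
Context {R : realType} {n : nat}.

Definition face_row (i : 'I_n.+2) (x : 'rV[R]_n.+1) : 'rV[R]_n.+2 :=
  \row_j if unlift i j is Some j' then x 0 j' else 0.

Lemma face_rowP (i : 'I_n.+2) (x : 'rV[R]_n.+1) :
  x \in std_simplex R n -> face_row i x \in std_simplex R n.+1.
Proof.
rewrite !inE => -[x0 x1]; split=> [j|].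
  by rewrite mxE; case: unlift.
rewrite (bigD1_ord i) //= mxE unlift_none add0r -x1.
by apply: eq_bigr => j _; rewrite mxE liftK.
Qed.

(* The inclusion of the face opposite to the [i]-th vertex. *)
Definition face_fun (i : 'I_n.+2) (x : std_simplex R n) : std_simplex R n.+1 :=
  exist _ (face_row i (\val x)) (face_rowP i (valP x)).

Lemma face_row_cont (i : 'I_n.+2) : continuous (face_row i).
Proof.
move=> x U [P Px PU].
have : \forall y \near x, forall j, P 0 j (face_row i y 0 j).
  apply: (@filter_forall _ _ (fun j y => P 0 j (face_row i y 0 j)) (nbhs x)) => j.
  have := Px 0 j; rewrite mxE.
  case Ej : (unlift i j) => [j'|] Pj; near=> y; rewrite mxE Ej.
    by near: y; apply: (coord_continuous (i := 0) (j := j')).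
  exact: nbhs_singleton Pj.
by apply: filterS => y Py; apply: PU => a j; rewrite (ord1 a).
Unshelve. all: by end_near. Qed.

Lemma face_fun_cont (i : 'I_n.+2) : continuous (face_fun i).
Proof.
apply: (@continuous_comp_initial _ _ _ (@set_val _ (std_simplex R n.+1))).
move=> x; apply: (@continuous_comp _ _ _ (@set_val _ (std_simplex R n)) (face_row i)).
  exact: initial_continuous.
exact: face_row_cont.
Qed.

Definition face (i : 'I_n.+2) :
  continuousType (std_simplex R n) (std_simplex R n.+1) :=
  mkcts (@face_fun_cont i).

End Faces.

Section Singular.
Context {R : realType} {X : topologicalType}.

Definition simplex (n : nat) := continuousType (std_simplex R n) X.

Definition simplex_face n (s : simplex n.+1) (i : 'I_n.+2) : simplex n :=
  s \o face i.

Context {A : zmodType}.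

(* The singular chains are the functions with finite support. *)
Definition is_chain n (c : simplex n -> A) : Prop :=
  finite_set [set s | c s != 0].

Definition boundary n (c : simplex n.+1 -> A) : simplex n -> A := fun t =>
  \sum_(s \in [set: simplex n.+1])
    \sum_(i < n.+2 | simplex_face s i == t) c s *~ ((-1) ^+ i).

Definition cycles n : set (simplex n -> A) :=
  match n with
  | 0 => fun c => is_chain c
  | m.+1 => fun c => is_chain c /\ boundary c = 0
  end.

Definition boundaries n : set (simplex n -> A) :=
  [set boundary b | b in @is_chain n.+1].

(* The singular cochains of degree [n] are all the functions on the singular
   [n]-simplices. *)
Definition coboundary n (phi : simplex n -> A) : simplex n.+1 -> A := fun s =>
  \sum_(i < n.+2) phi (simplex_face s i) *~ ((-1) ^+ i).

Definition cocycles n : set (simplex n -> A) := [set phi | coboundary phi = 0].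

Definition coboundaries n : set (simplex n -> A) :=
  match n with
  | 0 => [set 0]
  | m.+1 => range (@coboundary m)
  end.

(* The class modulo coboundaries of a cocycle; elements of H^n(X; A) are the
   sets [cohomology_class phi], with [phi] a cocycle. *)
Definition cohomology_class n (phi : simplex n -> A) : set (simplex n -> A) :=
  [set psi | coboundaries (psi - phi)].

End Singular.
Arguments simplex : clear implicits.

(* H_n(X; A) = 0. *)
Definition homology_vanishes (R : realType) (X : topologicalType)
    (A : zmodType) (n : nat) : Prop :=
  @cycles R X A n `<=` @boundaries R X A n.

Definition pullback (R : realType) (X Y : topologicalType) (A : zmodType) n
    (f : continuousType X Y) (phi : simplex R Y n -> A) : simplex R X n -> A :=
  fun s => phi (f \o s).

(** * Euler class *)

Section EulerClass.
Context {R : realType} {d k : nat} {M : manifold R d} (E : vector_bundle M k).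

Definition zero_section_fun (p : M) : total E := Total p 0.

Lemma zero_section_cont : continuous zero_section_fun.
Proof.
move=> p; have [t tE tp] := bundle_atlas_cover E p.
have [t_open _ t_cont _] := bundle_atlas_triv tE.
pose A := triv_dom t `*` [set: 'rV[R]_k].
have A_open : open A.
  rewrite openE => z [zt _]; exists (triv_dom t, setT) => //=.
  by split; [exact: open_nbhs_nbhs | exact: filterT].
move: t_cont; rewrite continuous_open_subspace // => t_cont.
have cont0 : {for p, continuous (fun q : M => (q, 0 : 'rV[R]_k))}.
  move=> U [[P Q] [/= Pp Q0] PQU]; apply: (filterS _ Pp) => q Pq.
  by apply: PQU; split => //=; exact: nbhs_singleton Q0.
have zt : (p, 0 : 'rV[R]_k) \in A by rewrite inE.
have := continuous_comp cont0 (t_cont _ zt).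
set h := _ \o _; have -> // : h = zero_section_fun.
by apply: funext => q; rewrite /h /= linear0.
Qed.

Definition zero_section : continuousType M (total E) := mkcts zero_section_cont.

Definition nonzero_vectors : set (total E) := [set e | vec e != 0].

Variable o : forall p, set (k.-tuple (E p)).

(* Orientation preserving affine embedding of the standard simplex in the fibre
   over [p], with vertices [a 0, ..., a k] and barycenter [0]. *)
Definition oriented_fibre_simplex (p : M) (s : simplex R (total E) k) : Prop :=
  exists a : 'I_k.+1 -> E p,
    [/\ \sum_j a j = 0,
        o [tuple a (lift ord0 j) - a ord0 | j < k] &
        forall x : std_simplex R k,
          s x = Total p (\sum_j (\val x : 'rV[R]_k.+1) 0 j *: a j)].

(* A cocycle representing the Thom class of [E] in H^k(E, E_0; Z): a cocycle of
   [E] vanishing on the simplices of the set [E_0] of nonzero vectors, whose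
   restriction to each fibre is the generator of H^k(E_p, E_p \ 0; Z) preferred
   by the orientation (Milnor-Stasheff). *)
Definition thom_cocycle (u : simplex R (total E) k -> int) : Prop :=
  [/\ cocycles u,
      forall s : simplex R (total E) k,
        (forall x, nonzero_vectors (s x)) -> u s = 0 &
      forall p s, oriented_fibre_simplex p s -> u s = 1].

(* The Euler class of [E] is the restriction to the zero section of the Thom
   class. *)
Definition is_euler_class (e : set (simplex R M k -> int)) : Prop :=
  exists2 u, thom_cocycle u & e = cohomology_class (pullback zero_section u).

End EulerClass.

(* Main.v *)
(* Suppose that the i-th eigenvalue of the frame operator A A^T is simple
   everywhere.  The adjoint of A embeds its eigenline in R^n as the eigenline of
   the Gram matrix A^T A, for the same eigenvalue, which gives a continuous
   field of lines in R^n over M.  Relative to an arbitrary choice of unit vectors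
   in these lines, parallel transport along paths is a mod 2 singular 1-cocycle;
   since H_1(M; Z/2) = 0 it is a coboundary, so that signs can be chosen to get a
   continuous field v of unit vectors, and A v is a continuous nowhere zero section of E.  Scaling it by t
   in [0, 1] yields a homotopy from the zero section to a map into the nonzero
   vectors, where the Thom cocycle vanishes: the Euler class is zero. *)

Require Import Defs.
From HB Require Import structures.
From mathcomp Require Import all_boot all_order all_algebra.
From mathcomp Require Import all_classical all_reals all_analysis.
From mathcomp Require Import lra zify finmap.

Set Implicit Arguments.
Unset Strict Implicit.
Unset Printing Implicit Defensive.

Import Order.TTheory GRing.Theory Num.Theory.
Import numFieldNormedType.Exports passmx.

Local Open Scope classical_set_scope.
Local Open Scope ring_scope.

(** * Continuity of matrices and of the coefficients of polynomials *)

(** The eigenline is taken in the fixed space R^n, not in the fibres of E, so that lines over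
    different points are compared by matrices and the standard dot product, without local frames.
    The price is that the Gram matrix has the extra eigenvalue 0 when n > k; it is distinct from the
    chosen one because [A] is surjective, which makes every eigenvalue of the frame operator
    nonzero. Continuity of the line comes from a formula: if the characteristic polynomial of [G] is
    (X - l) h with h(l) nonzero, then adj(l - G) / h(l) projects onto the line, and [l] is
    continuous as a sorted root of a real-rooted polynomial. The double cover of unit vectors is
    never built: transport over a simplex is a finite composition of projections, and only the signs
    at the two ends of a path are kept. *)

Lemma continuous_at_near (T S : topologicalType) (x : T) (f h : T -> S) :
  continuous_at x f -> (\forall y \near x, f y = h y) -> continuous_at x h.
Proof.
move=> fc fh; rewrite /continuous_at -(nbhs_singleton fh).
by apply: cvg_trans fc; apply: near_eq_cvg; apply: filterS fh => y ->.
Qed.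

Lemma continuous_at_pair (T S1 S2 : topologicalType) (x : T) (f : T -> S1) (h : T -> S2) :
  continuous_at x f -> continuous_at x h -> continuous_at x (fun y => (f y, h y)).
Proof.
move=> fc hc U [[A B] /= [Ax Bx] ABU].
have fA : \forall y \near x, A (f y) by exact: fc.
have hB : \forall y \near x, B (h y) by exact: hc.
by apply: filterS2 fA hB => y Ay By; apply: ABU.
Qed.

Lemma within_open_continuous_at (T S : topologicalType) (U : set T) (f : T -> S) x :
  open U -> {within U, continuous f} -> U x -> continuous_at x f.
Proof.
move=> oU; rewrite continuous_open_subspace // => fc Ux; apply: fc; exact: mem_set.
Qed.

Section ContinuousAt.
Context {R : realType} {T : topologicalType} (x : T).

Lemma continuous_atD (f h : T -> R) :
  continuous_at x f -> continuous_at x h -> continuous_at x (fun y => f y + h y).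
Proof. exact: cvgD. Qed.

Lemma continuous_atB (f h : T -> R) :
  continuous_at x f -> continuous_at x h -> continuous_at x (fun y => f y - h y).
Proof. exact: cvgB. Qed.

Lemma continuous_atM (f h : T -> R) :
  continuous_at x f -> continuous_at x h -> continuous_at x (fun y => f y * h y).
Proof. exact: cvgM. Qed.

Lemma continuous_atV (f : T -> R) :
  f x != 0 -> continuous_at x f -> continuous_at x (fun y => (f y)^-1).
Proof. by move=> fx fc; exact: cvgV. Qed.

Lemma continuous_at_sum (I : Type) (r : seq I) (P : pred I) (f : I -> T -> R) :
  (forall i, P i -> continuous_at x (f i)) ->
  continuous_at x (fun y => \sum_(i <- r | P i) f i y).
Proof.
move=> fc; elim: r => [|i r IHr].
  by under eq_fun do rewrite big_nil; exact: cvg_cst.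
under eq_fun do rewrite big_cons.
by case: ifP => // Pi; apply: continuous_atD; [exact: fc | exact: IHr].
Qed.

Lemma continuous_at_prod (I : Type) (r : seq I) (P : pred I) (f : I -> T -> R) :
  (forall i, P i -> continuous_at x (f i)) ->
  continuous_at x (fun y => \prod_(i <- r | P i) f i y).
Proof.
move=> fc; elim: r => [|i r IHr].
  by under eq_fun do rewrite big_nil; exact: cvg_cst.
under eq_fun do rewrite big_cons.
by case: ifP => // Pi; apply: continuous_atM; [exact: fc | exact: IHr].
Qed.

Lemma continuous_at_mx m n (f : T -> 'M[R]_(m, n)) :
  (forall i j, continuous_at x (fun y => f y i j)) -> continuous_at x f.
Proof.
move=> fc U [P Px PU].
have : \forall y \near x, forall i j, P i j (f y i j).
  apply: filter_forall => i; apply: filter_forall => j.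
  by have := Px i j; exact: fc.
by apply: filterS => y Py; apply: PU.
Qed.

Lemma continuous_at_coord m n (f : T -> 'M[R]_(m, n)) i j :
  continuous_at x f -> continuous_at x (fun y => f y i j).
Proof.
move=> fc; apply: (@continuous_comp _ _ _ f (fun A : 'M[R]_(m, n) => A i j)) => //.
exact: coord_continuous.
Qed.

Lemma continuous_at_scale m n (a : T -> R) (f : T -> 'M[R]_(m, n)) :
  continuous_at x a -> continuous_at x f -> continuous_at x (fun y => a y *: f y).
Proof.
move=> ac fc; apply: continuous_at_mx => i j; under eq_fun do rewrite mxE.
by apply: continuous_atM => //; exact: continuous_at_coord.
Qed.

Lemma continuous_at_mulmx m n p (f : T -> 'M[R]_(m, n)) (h : T -> 'M[R]_(n, p)) :
  continuous_at x f -> continuous_at x h ->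
  continuous_at x (fun y => f y *m h y).
Proof.
move=> fc hc; apply: continuous_at_mx => i j.
under eq_fun do rewrite mxE.
by apply: continuous_at_sum => l _ /=; apply: continuous_atM; exact: continuous_at_coord.
Qed.

Lemma continuous_at_det n (f : T -> 'M[R]_n) :
  continuous_at x f -> continuous_at x (fun y => \det (f y)).
Proof.
move=> fc; rewrite /determinant.
apply: continuous_at_sum => s _ /=.
apply: continuous_atM; first exact: cvg_cst.
by apply: continuous_at_prod => i _; exact: continuous_at_coord.
Qed.

Lemma continuous_at_adj n (f : T -> 'M[R]_n) :
  continuous_at x f -> continuous_at x (fun y => \adj (f y)).
Proof.
move=> fc; apply: continuous_at_mx => i j; under eq_fun do rewrite mxE.
apply: continuous_atM; first exact: cvg_cst.
apply: continuous_at_det; apply: continuous_at_mx => a b.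
by under eq_fun do rewrite !mxE; exact: continuous_at_coord.
Qed.

Definition coef_continuous_at (f : T -> {poly R}) :=
  forall m, continuous_at x (fun y => (f y)`_m).

Lemma coef_continuous_at_cst p : coef_continuous_at (fun=> p).
Proof. by move=> m; exact: cvg_cst. Qed.

Lemma coef_continuous_atC (f : T -> R) :
  continuous_at x f -> coef_continuous_at (fun y => (f y)%:P).
Proof.
move=> fc m; under eq_fun do rewrite coefC.
by case: ifP => // _; exact: cvg_cst.
Qed.

Lemma coef_continuous_atB f h :
  coef_continuous_at f -> coef_continuous_at h ->
  coef_continuous_at (fun y => f y - h y).
Proof.
by move=> fc hc m; under eq_fun do rewrite coefB; apply: continuous_atB.
Qed.

Lemma coef_continuous_atM f h :
  coef_continuous_at f -> coef_continuous_at h ->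
  coef_continuous_at (fun y => f y * h y).
Proof.
move=> fc hc m; under eq_fun do rewrite coefM.
by apply: continuous_at_sum => l _; apply: continuous_atM.
Qed.

Lemma coef_continuous_at_sum (I : Type) (r : seq I) (P : pred I)
    (f : I -> T -> {poly R}) :
  (forall i, P i -> coef_continuous_at (f i)) ->
  coef_continuous_at (fun y => \sum_(i <- r | P i) f i y).
Proof.
move=> fc m; under eq_fun do rewrite coef_sum.
by apply: continuous_at_sum => i Pi; exact: fc.
Qed.

Lemma coef_continuous_at_prod (I : Type) (r : seq I) (P : pred I)
    (f : I -> T -> {poly R}) :
  (forall i, P i -> coef_continuous_at (f i)) ->
  coef_continuous_at (fun y => \prod_(i <- r | P i) f i y).
Proof.
move=> fc; elim: r => [|i r IHr].
  by under eq_fun do rewrite big_nil; exact: coef_continuous_at_cst.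
under eq_fun do rewrite big_cons.
by case: ifP => // Pi; apply: coef_continuous_atM; [exact: fc | exact: IHr].
Qed.

Lemma coef_continuous_at_char_poly n (f : T -> 'M[R]_n) :
  continuous_at x f -> coef_continuous_at (fun y => char_poly (f y)).
Proof.
move=> fc; rewrite /char_poly /determinant.
apply: coef_continuous_at_sum => s _; apply: coef_continuous_atM.
  exact: coef_continuous_at_cst.
apply: coef_continuous_at_prod => i _; under eq_fun do rewrite !mxE.
apply: coef_continuous_atB; first exact: coef_continuous_at_cst.
by apply: coef_continuous_atC; exact: continuous_at_coord.
Qed.

(** Synthetic division from the top: the coefficients of the quotient satisfy h_m = f_(m+1) + c
    h_(m+1) and vanish from index [N] on, so continuity descends by induction on [N - m]. *)
Lemma coef_continuous_at_deflation N (c : T -> R) (f h : T -> {poly R}) :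
  (forall y, size (h y) <= N)%N -> (forall y, f y = ('X - (c y)%:P) * h y) ->
  continuous_at x c -> coef_continuous_at f -> coef_continuous_at h.
Proof.
move=> hN fE cc fc m.
have [k] := ubnP (N - m); elim: k m => // k IHk m le_k.
have [leNm|ltmN] := leqP N m.
  suff -> : (fun y => (h y)`_m) = fun=> 0 by exact: cvg_cst.
  by apply/funext => y; rewrite nth_default // (leq_trans _ leNm).
have -> : (fun y => (h y)`_m) = (fun y => (f y)`_m.+1 + c y * (h y)`_m.+1).
  by apply/funext => y; rewrite fE mulrBl coefB coefXM coefCM /= subrK.
apply: continuous_atD; first exact: fc.
by apply: continuous_atM => //; apply: IHk; lia.
Qed.

End ContinuousAt.

(** * Continuity of the sorted roots of real-rooted polynomials *)

Section RealRoots.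
Context {R : realType}.

Definition roots_poly k (lam : 'I_k -> R) : {poly R} :=
  \prod_(j < k) ('X - (lam j)%:P).

Lemma size_roots_poly k (lam : 'I_k -> R) : size (roots_poly lam) = k.+1.
Proof.
by rewrite /roots_poly size_prod_XsubC -[index_enum _]enumT size_enum_ord.
Qed.

Lemma root_roots_poly k (lam : 'I_k -> R) j : (roots_poly lam).[lam j] = 0.
Proof.
by rewrite /roots_poly (bigD1 j) //= hornerM hornerXsubC subrr mul0r.
Qed.

Lemma shifted_roots_poly k (lam : 'I_k -> R) a :
  roots_poly lam \Po ('X + a%:P) = roots_poly (fun j => lam j - a).
Proof.
rewrite /roots_poly rmorph_prod /=; apply: eq_bigr => j _.
by rewrite comp_polyB comp_polyX comp_polyC polyCB opprB addrA addrAC.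
Qed.

Lemma roots_poly_coef_ge0 k (lam : 'I_k -> R) m :
  (forall j, lam j <= 0) -> 0 <= (roots_poly lam)`_m.
Proof.
rewrite /roots_poly => lam0; elim/big_rec: _ m => [|j p _ p0] m.
  by rewrite coef1; case: eqP.
rewrite mulrBl coefB coefXM coefCM -mulNr addr_ge0 ?mulr_ge0 ?oppr_ge0 //.
by case: m.
Qed.

Lemma roots_poly_coef_gt0 k (lam : 'I_k -> R) m :
  (forall j, lam j < 0) -> (m <= k)%N -> 0 < (roots_poly lam)`_m.
Proof.
elim: k lam m => [|k IHk] lam m lam0 mk.
  by move: mk; rewrite leqn0 => /eqP ->; rewrite /roots_poly big_ord0 coef1.
rewrite /roots_poly big_ord_recl mulrBl coefB coefXM coefCM -mulNr.
rewrite -/(roots_poly (fun j => lam (lift ord0 j))).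
case: m mk => [|m] mk /=.
  by rewrite add0r mulr_gt0 ?oppr_gt0 // IHk.
rewrite ltr_wpDr ?IHk // mulr_ge0 ?oppr_ge0 ?(ltW (lam0 _)) //.
by rewrite roots_poly_coef_ge0 // => j; rewrite ltW.
Qed.

(* [a] bounds all the roots of a real-rooted monic polynomial [f] exactly when
   [f(X + a)] has no negative coefficient: an open condition in both
   directions, up to the strictness of the bound. *)
Lemma continuous_at_max_root (T : topologicalType) (x : T) k
    (lam : T -> 'I_k.+1 -> R) :
  (forall y j, lam y j <= lam y ord0) ->
  coef_continuous_at x (fun y => roots_poly (lam y)) ->
  continuous_at x (fun y => lam y ord0).
Proof.
move=> lam_max fc.
pose f a y := roots_poly (fun j => lam y j - a).
have fac a : coef_continuous_at x (f a).
  move=> m; rewrite /f; under eq_fun => y.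
    rewrite -shifted_roots_poly comp_polyE size_roots_poly coef_sum.
    over.
  apply: continuous_at_sum => l _ /=; under eq_fun do rewrite coefZ.
  apply: (@continuous_atM _ _ x (fun y => (roots_poly (lam y))`_l)
    (fun=> (('X + a%:P) ^+ l)`_m)); [exact: fc | exact: cvg_cst].
have frt a y : (f a y).[lam y ord0 - a] = 0 by apply: (root_roots_poly _ ord0).
apply/cvgrPdist_lt => e e0; near=> y.
rewrite ltr_distlC; apply/andP; split; near: y.
- pose a := lam x ord0 - e.
  (* Otherwise all coefficients are nonnegative and the leading one is 1, so the value at the
     positive number [lam x ord0 - a = e] would be positive, although it is a root. *)
  have [m fm] : exists m, (f a x)`_m < 0.
    apply: contrapT => /forallNP fge.
    suff : 0 < (f a x).[lam x ord0 - a] by rewrite frt ltxx.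
    rewrite horner_coef size_roots_poly big_ord_recr /=.
    rewrite ltr_wpDl ?sumr_ge0 // => [l _|].
      rewrite mulr_ge0 ?exprn_ge0 //; first by rewrite leNgt; apply/negP/fge.
      by rewrite /a; lra.
    have := monicP (monic_prod_XsubC (index_enum 'I_k.+1) xpredT
       (fun j => lam x j - a)).
    rewrite lead_coefE -/(roots_poly (fun j => lam x j - a)) size_roots_poly /=.
    by move=> ->; rewrite mul1r exprn_gt0 // /a; lra.
  have : \forall y \near x, (f a y)`_m < 0 by exact: (cvgr_lt _ (fac a m)).
  apply: filterS => y; rewrite -/a !ltNge; apply: contra => le_a.
  by apply: roots_poly_coef_ge0 => j; rewrite subr_le0 (le_trans (lam_max _ _)).
- pose a := lam x ord0 + e.
  have : \forall y \near x, forall m : 'I_k.+2, 0 < (f a y)`_m.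
    apply: filter_forall => m; apply: (cvgr_gt _ (fac a m)).
    apply: roots_poly_coef_gt0; last by rewrite -ltnS.
    by move=> j; have := lam_max x j; rewrite /a; lra.
  apply: filterS => y fgt; rewrite -/a ltNge; apply/negP => le_a.
  suff : 0 < (f a y).[lam y ord0 - a] by rewrite frt ltxx.
  rewrite horner_coef size_roots_poly big_ord_recl /=.
  rewrite ltr_wpDr ?sumr_ge0 // => [l _|].
    by rewrite mulr_ge0 ?exprn_ge0 ?subr_ge0 // ltW // (fgt (lift ord0 l)).
  by rewrite expr0 mulr1 (fgt ord0).
Unshelve. all: by end_near. Qed.

(** The largest root is continuous; dividing by its linear factor keeps the coefficients continuous
    and leaves the remaining roots, still sorted, so induction on the degree applies. *)
Lemma continuous_at_sorted_root (T : topologicalType) (x : T) k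
    (lam : T -> 'I_k -> R) :
  (forall y (i j : 'I_k), (i <= j)%N -> lam y j <= lam y i) ->
  coef_continuous_at x (fun y => roots_poly (lam y)) ->
  forall i, continuous_at x (fun y => lam y i).
Proof.
elim: k lam => [|k IHk] lam lam_sorted fc i; first by case: i.
have c0 : continuous_at x (fun y => lam y ord0).
  by apply: continuous_at_max_root => // y j; exact: lam_sorted.
case: (unliftP ord0 i) => [j ->|-> //].
apply: (IHk (fun y j => lam y (lift ord0 j))) => [y a b ab|].
  by apply: lam_sorted; rewrite /= /bump /= !add1n ltnS.
apply: (coef_continuous_at_deflation (N := k.+1) _ _ c0 fc).
  by move=> y; rewrite size_roots_poly.
by move=> y; rewrite /roots_poly big_ord_recl.
Qed.

End RealRoots.

(** * Characteristic polynomials and simple eigenvalues *)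

(** Both sides come from the block matrix [N] with rows (X, A) and (B, 1). Clearing [B] by column
    operations gives the characteristic polynomial of AB; multiplying the lower rows by X and
    clearing XB by row operations gives the other side. No inverse is taken, so any commutative ring
    will do. *)
Lemma char_poly_mulmxC (R : comNzRingType) m n (A : 'M[R]_(m, n)) (B : 'M[R]_(n, m)) :
  'X^n * char_poly (A *m B) = 'X^m * char_poly (B *m A).
Proof.
pose A' := map_mx polyC A; pose B' := map_mx polyC B.
pose N := block_mx ('X%:M : 'M[{poly R}]_m) A' B' (1%:M : 'M[{poly R}]_n).
have NAB : \det N = char_poly (A *m B).
  have <- : \det (N *m block_mx 1%:M 0 (- B') 1%:M) = \det N.
    by rewrite det_mulmx det_lblock !det1 !mulr1.
  rewrite mulmx_block !mulmx1 !mul1mx !mulmx0 ?add0r subrr det_ublock det1 mulr1.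
  by rewrite mulmxN -map_mxM.
have NBA : 'X^n * \det N = 'X^m * char_poly (B *m A).
  have <- : \det (block_mx 1%:M 0 (- B') 'X%:M *m N) = 'X^n * \det N.
    by rewrite det_mulmx det_lblock det1 mul1r det_scalar.
  rewrite mulmx_block !mul1mx !mul0mx !addr0 mulmx1 mul_mx_scalar mul_scalar_mx.
  rewrite scalerN addNr det_ublock det_scalar.
  by rewrite mulNmx -map_mxM addrC.
by rewrite -NAB.
Qed.

Section SimpleEigenvalue.
Context {F : fieldType} {n : nat} (G : 'M[F]_n) (l : F) (h : {poly F}).
Hypothesis char_polyE : char_poly G = ('X - l%:P) * h.
Hypothesis h_l : h.[l] != 0.

Let B := l%:M - G.

(** The spectral projection at a simple root, for matrices acting on row vectors. The adjugate makes
    it rational in [G], [l] and the coefficients of [h], hence continuous in parameters. *)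
Definition eigenprojector : 'M[F]_n := h.[l]^-1 *: \adj B.

Let eigen_kernel (v : 'rV[F]_n) : (v *m G = l *: v) <-> (v *m B = 0).
Proof.
rewrite /B mulmxBr mul_mx_scalar; split=> [->|/eqP]; first exact: subrr.
by rewrite subr_eq0 => /eqP.
Qed.

Let map_char_poly_mx_at : map_mx (horner_eval l) (char_poly_mx G) = B.
Proof.
apply/matrixP => a b; rewrite !mxE /= /horner_eval hornerD hornerN hornerC.
by rewrite hornerMn hornerX.
Qed.

(** Since v (X - G) = (X - l) v, multiplying by adj(X - G) gives (X - l) h v = (X - l) v adj(X - G).
    The factor X - l cancels over polynomials; only then is X set to [l]. *)
Let kernel_adj (v : 'rV[F]_n) : v *m B = 0 -> v *m \adj B = h.[l] *: v.
Proof.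
move=> /eigen_kernel vG; pose V := map_mx polyC v.
have VX : V *m char_poly_mx G = ('X - l%:P) *: V.
  rewrite /char_poly_mx mulmxBr mul_mx_scalar -map_mxM vG map_mxZ.
  by rewrite scalerBl.
have Vh : V *m \adj (char_poly_mx G) = h *: V.
  have : V *m (char_poly_mx G *m \adj (char_poly_mx G)) = char_poly G *: V.
    by rewrite mul_mx_adj mul_mx_scalar.
  rewrite mulmxA VX -scalemxAl char_polyE -scalerA.
  move=> /matrixP e; apply/matrixP => a b; have := e a b.
  by rewrite !mxE; apply: mulfI; rewrite polyXsubC_eq0.
rewrite -map_char_poly_mx_at -map_mx_adj.
have /(congr1 (map_mx (horner_eval l))) := Vh.
rewrite map_mxM map_mxZ /V -map_mx_comp.
have -> : map_mx (horner_eval l \o polyC) v = v.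
  by apply/matrixP => a b; rewrite !mxE /= /horner_eval hornerC.
by [].
Qed.

Let adj_kernel : \adj B *m B = 0.
Proof.
rewrite mul_adj_mx.
have -> : \det B = (char_poly G).[l].
  by rewrite -map_char_poly_mx_at det_map_mx.
by rewrite char_polyE hornerM hornerXsubC subrr mul0r raddf0.
Qed.

Lemma eigenprojector_fix (v : 'rV[F]_n) : v *m G = l *: v -> v *m eigenprojector = v.
Proof.
move=> /eigen_kernel /kernel_adj vB.
by rewrite -scalemxAr vB scalerA mulVf // scale1r.
Qed.

Lemma eigenprojector_eigen (v : 'rV[F]_n) :
  (v *m eigenprojector) *m G = l *: (v *m eigenprojector).
Proof.
by apply/eigen_kernel; rewrite -mulmxA -scalemxAl adj_kernel scaler0 mulmx0.
Qed.

(* If [v i = 0] for a nonzero [v] in the kernel of [B], then deleting the [i]-th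
   row of [B] leaves linearly dependent rows. *)
Let cofactor_kernel (v : 'rV[F]_n) i j :
  v *m B = 0 -> v 0 i = 0 -> v != 0 -> cofactor B i j = 0.
Proof.
move=> vB vi v0; rewrite /cofactor; apply/eqP.
rewrite mulf_eq0; apply/orP; right; apply/det0P; exists (col' i v).
  apply: contra v0 => /eqP/rowP v'0; apply/eqP/rowP => a; rewrite mxE.
  by case: (unliftP i a) => [b ->|-> //]; have := v'0 b; rewrite !mxE.
apply/rowP => b; have /rowP/(_ (lift j b)) := vB.
rewrite !mxE (bigD1_ord i) //= vi mul0r add0r => e; rewrite -[RHS]e.
by apply: eq_bigr => a _; rewrite !mxE.
Qed.

(** The adjugate has a nonzero entry [(\adj B) j i], as it multiplies [v] by [h.[l]]. For kernel
    vectors x and y, the combination x_i y - y_i x is in the kernel with zero i-th coordinate, so it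
    vanishes, or that cofactor would be zero. *)
Lemma eigenvector_unique (u v : 'rV[F]_n) :
  u *m G = l *: u -> v *m G = l *: v -> v != 0 -> exists a, u = a *: v.
Proof.
move=> /eigen_kernel uB /eigen_kernel vB v0.
have [j [i adjB]] : exists j i, (\adj B) j i != 0.
  apply: contra_notP (negP v0) => /forallNP adj0.
  suff a0 : \adj B = 0.
    by have := kernel_adj vB; rewrite a0 mulmx0 => /esym/eqP; rewrite scaler_eq0 (negPf h_l).
  apply/matrixP => a b; rewrite [RHS]mxE; apply/eqP/negP => /negP.
  by have /forallNP := adj0 a; apply.
have prop (x y : 'rV[F]_n) : x *m B = 0 -> y *m B = 0 -> x 0 i *: y = y 0 i *: x.
  move=> xB yB; apply/eqP; rewrite -subr_eq0.
  apply: contraNT adjB => z0; rewrite mxE; apply/eqP; apply: cofactor_kernel z0.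
    by rewrite mulmxBl -!scalemxAl xB yB !scaler0 subrr.
  by rewrite !mxE mulrC subrr.
have wB : row j (\adj B) *m B = 0 by rewrite -row_mul adj_kernel raddf0.
have vi : v 0 i != 0.
  apply: contra v0 => /eqP vi; have := prop _ _ wB vB.
  by rewrite vi scale0r mxE => /eqP; rewrite scaler_eq0 (negPf adjB).
exists (u 0 i / v 0 i); apply: (scalerI vi).
by rewrite scalerA mulrCA divff // mulr1 -(prop _ _ uB vB).
Qed.

End SimpleEigenvalue.

(** The powers of X allow for characteristic polynomials of matrices of different sizes; as [lam i]
    is nonzero they affect neither its being a root nor its simplicity. *)
Lemma simple_root_factor (F : fieldType) k (lam : 'I_k -> F) (i : 'I_k) a b
    (f : {poly F}) :
  'X^a * \prod_(j < k) ('X - (lam j)%:P) = 'X^b * f ->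
  lam i != 0 -> (forall j, lam j = lam i -> j = i) ->
  exists2 h, f = ('X - (lam i)%:P) * h & h.[lam i] != 0.
Proof.
move=> fE li0 simple.
have Xl m : ('X^m : {poly F}).[lam i] != 0 by rewrite hornerXn expf_neq0.
have rf : root f (lam i).
  have /(congr1 (fun p => p.[lam i])) := fE.
  rewrite hornerM (bigD1 i) //= !hornerM hornerXsubC subrr mul0r mulr0.
  by move=> /esym/eqP; rewrite mulf_eq0 (negPf (Xl b)) rootE.
have /factor_theorem[h fh] := rf; rewrite mulrC in fh.
exists h => //.
have : 'X^a * \prod_(j < k | j != i) ('X - (lam j)%:P) = 'X^b * h.
  apply: (@mulfI _ ('X - (lam i)%:P)); first by rewrite polyXsubC_eq0.
  by rewrite mulrCA [RHS]mulrCA -fh -fE [in RHS](bigD1 i).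
move=> /(congr1 (fun p => p.[lam i])); rewrite !hornerM => hE.
have : 'X^b.[lam i] * h.[lam i] != 0.
  rewrite -hE mulf_neq0 // horner_prod; apply/prodf_neq0 => j ji.
  rewrite hornerXsubC subr_eq0 eq_sym.
  by apply: contra ji => /eqP/simple ->.
by rewrite mulf_eq0 negb_or => /andP[].
Qed.

(** * Simplices *)

Section SimplexTopology.
Context {R : realType} {m : nat}.
Local Notation K := (std_simplex R m).

Lemma simplex_val_continuous : continuous (fun x : K => \val x : 'rV[R]_m.+1).
Proof. exact: initial_continuous. Qed.

Lemma to_simplex_continuous (T : topologicalType) (f : T -> K) :
  continuous (fun y => \val (f y) : 'rV[R]_m.+1) -> continuous f.
Proof. exact: (@continuous_comp_initial _ _ _ (@set_val _ (std_simplex R m))). Qed.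

Lemma compact_std_simplex : compact K.
Proof.
apply: bounded_closed_compact.
  exists 1; split=> // M M1 x [x0 x1]; apply: le_trans (ltW M1).
  rewrite [leLHS]/Num.norm /= mx_normrE; apply/bigmax_leP; split=> // -[i j] _ /=.
  rewrite (ord1 i) ger0_norm // -x1 (bigD1 j) //= lerDl.
  by apply: sumr_ge0.
rewrite (_ : K = \bigcap_j ((fun x : 'rV[R]_m.+1 => x 0 j) @^-1` [set t | 0 <= t])
    `&` ((fun x : 'rV[R]_m.+1 => \sum_j x 0 j) @^-1` [set 1])).
  apply: closedI.
    apply: closed_bigI => j _; apply: preimage_closed; last exact: closed_ge.
    by move=> x _; exact: coord_continuous.
  apply: preimage_closed; last exact: closed_eq.
  by move=> x _; apply: continuous_at_sum => j _; exact: coord_continuous.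
apply/seteqP; split=> x /= [x0 x1]; split => // j; first by move=> _; exact: x0.
exact: x0.
Qed.

Lemma compact_simplexT : compact [set: K].
Proof.
apply/compact_near_coveringP => I F Q FF Qnear.
have /compact_near_coveringP/(_ I F
    (fun i z => forall h : z \in K, Q i (exist _ z h)) FF) cov := compact_std_simplex.
apply: (filterS _ (cov _)).
  move=> i KQ [z h] _; apply: KQ; exact: set_mem.
move=> z /mem_set zK; have [[U V] /= [[W [Wo zO] OU] FV] UVQ] := Qnear (exist _ z zK) Logic.I.
have [Y oY YW] := Wo; rewrite -{}YW in zO OU.
exists (Y, V) => /=; first by split=> //; exact: open_nbhs_nbhs.
by move=> [z' i] /= [z'O iV] h; apply: (UVQ (exist _ z' h, i)); split=> //=; exact: OU.
Qed.

End SimplexTopology.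

(** * Vertices and segments of the standard simplex, and uniform continuity along them *)

Section Paths.
Context {R : realType} {m : nat}.
Local Notation K := (std_simplex R m).

Lemma vertex_subproof (i : 'I_m.+1) : (delta_mx 0 i : 'rV[R]_m.+1) \in K.
Proof.
apply/mem_set; split=> [j|]; first by rewrite mxE ler0n.
rewrite (bigD1 i) //= mxE !eqxx big1 ?addr0 // => j ji.
by rewrite mxE (negPf ji) andbF.
Qed.

Definition vertex (i : 'I_m.+1) : K := exist _ (delta_mx 0 i) (vertex_subproof i).

Definition clamp (t : R) : R := Num.max 0 (Num.min 1 t).

Lemma clamp_ge0 t : 0 <= clamp t.
Proof. by rewrite /clamp le_max lexx. Qed.

Lemma clamp_le1 t : clamp t <= 1.
Proof. by rewrite /clamp ge_max ler01 ge_min lexx. Qed.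

Lemma clamp_id t : 0 <= t <= 1 -> clamp t = t.
Proof. by move=> /andP[t0 t1]; rewrite /clamp (min_r t1) (max_r t0). Qed.

Lemma clamp_continuous : continuous clamp.
Proof.
move=> t; rewrite /clamp.
apply: (@continuous_max _ _ (fun=> 0) (fun t : R => Num.min 1 t)); first exact: cvg_cst.
by apply: (@continuous_min _ _ (fun=> 1) id); [exact: cvg_cst | exact: cvg_id].
Qed.

Definition segment_row (a b : 'rV[R]_m.+1) (t : R) : 'rV[R]_m.+1 :=
  (1 - clamp t) *: a + clamp t *: b.

Lemma segment_subproof (a b : K) (t : R) : segment_row (\val a) (\val b) t \in K.
Proof.
have /set_mem[a0 a1] := valP a; have /set_mem[b0 b1] := valP b.
have c1 : 0 <= 1 - clamp t by rewrite subr_ge0 clamp_le1.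
apply/mem_set; split=> [j|].
  by rewrite !mxE addr_ge0 // mulr_ge0 ?clamp_ge0.
under eq_bigr do rewrite !mxE.
by rewrite big_split /= -!mulr_sumr; move: a1 b1 => /= -> ->; rewrite !mulr1 subrK.
Qed.

(* Clamping [t] to [0, 1] makes this continuous on all of [R]. *)
Definition segment (a b : K) (t : R) : K :=
  exist _ (segment_row (\val a) (\val b) t) (segment_subproof a b t).

Lemma segment0 a b : segment a b 0 = a.
Proof.
by apply: val_inj; rewrite /= /segment_row clamp_id ?lexx ?ler01 // subr0 scale1r scale0r addr0.
Qed.

Lemma segment1 a b : segment a b 1 = b.
Proof.
by apply: val_inj; rewrite /= /segment_row clamp_id ?lexx ?ler01 // subrr scale1r scale0r add0r.
Qed.

Lemma segment_continuous a : continuous (fun z : K * R => segment a z.1 z.2).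
Proof.
apply: to_simplex_continuous => z; apply: continuous_at_mx => i j.
have cz : continuous_at z (fun z : K * R => clamp z.2).
  by apply: continuous_comp; [exact: cvg_snd | exact: clamp_continuous].
have -> : (fun z : K * R => (\val (segment a z.1 z.2) : 'rV[R]_m.+1) i j) =
    (fun z : K * R => (1 - clamp z.2) * (\val a : 'rV[R]_m.+1) i j +
                      clamp z.2 * (\val z.1 : 'rV[R]_m.+1) i j).
  by apply/funext => y; rewrite /= /segment_row !mxE.
apply: continuous_atD; apply: continuous_atM => //.
- by apply: continuous_atB => //; exact: cvg_cst.
- exact: cvg_cst.
- apply: (@continuous_comp _ _ _ fst (fun x : K => (\val x : 'rV[R]_m.+1) i j)).
    exact: cvg_fst.
  by apply: continuous_at_coord; exact: simplex_val_continuous.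
Qed.

Lemma segment_continuousr a b : continuous (segment a b).
Proof.
move=> t; apply: (@continuous_comp _ _ _ (fun t : R => (b, t))
  (fun z : K * R => segment a z.1 z.2)).
  move=> U [[P Q] [/= Pb Qt] PQU]; apply: (filterS _ Qt) => t' Qt'.
  by apply: PQU; split=> //=; exact: nbhs_singleton Pb.
exact: segment_continuous.
Qed.

(** [S] has no uniform structure: uniformity is only in the real variable, with one [r] for all [y],
    which is what the near-covering form of compactness of S x [0, 1] provides. *)
Lemma uniformly_continuous_on_compact (S : topologicalType) (f : S * R -> R) (e : R) :
  compact [set: S] -> continuous f -> 0 < e ->
  \forall r \near 0^'+, forall y t t', 0 <= t <= 1 -> `|t - t'| < r ->
    `|f (y, t) - f (y, t')| < e.
Proof.
move=> Scpt fc e0.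
have cpt : compact ([set: S] `*` `[0 : R, 1]%classic).
  by apply: compact_setX => //; exact: segment_compact.
pose close (r : R) (z : S * R) :=
  forall t', `|z.2 - t'| < r -> `|f z - f (z.1, t')| < e.
suff cov : forall z, ([set: S] `*` `[0 : R, 1]%classic) z ->
    \forall z' \near z & r \near 0^'+, close r z'.
  have /compact_near_coveringP/(_ R (0^'+) close _ cov) := cpt.
  apply: filterS => r {}cov y t t' t01; apply: (cov (y, t)).
  by split=> //=; rewrite in_itv.
move=> [y t] _.
have : \forall z \near (y, t), `|f (y, t) - f z| < e / 2.
  by move/cvgrPdist_lt : (fc (y, t)); apply; rewrite divr_gt0.
move=> [[U V] /= [Uy /nbhs_ballP[r /= r0 rV]] UV].
exists (U `*` ball t (r / 2), [set r' | r' < r / 2]) => /=.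
  split; first exists (U, ball t (r / 2)) => //=.
    by split=> //; apply: nbhsx_ballx; rewrite divr_gt0.
  by apply: nbhs_right_lt; rewrite divr_gt0.
move=> [[y' s] r'] /= [[Uy' ts] r'r] s' ss'.
have sV : V s by apply: rV; apply: le_ball ts; lra.
have s'V : V s'.
  apply: rV; move: ts; rewrite /ball /= => ts.
  have := ler_distD s t s'; lra.
have := UV (y', s) (conj Uy' sV); have := UV (y', s') (conj Uy' s'V).
have := ler_distD (f (y, t)) (f (y', s)) (f (y', s')).
by rewrite (distrC (f (y', s)) (f (y, t))); lra.
Qed.

End Paths.

(** * Fields of lines over simplices *)

Section Dot.
Context {R : realType} {n : nat}.
Implicit Types u v w : 'rV[R]_n.

Definition dot u v : R := \sum_j u 0 j * v 0 j.

Lemma dotC u v : dot u v = dot v u.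
Proof. by apply: eq_bigr => j _; rewrite mulrC. Qed.

Lemma dotZl a u v : dot (a *: u) v = a * dot u v.
Proof. by rewrite /dot mulr_sumr; apply: eq_bigr => j _; rewrite mxE mulrA. Qed.

Lemma dotZr a u v : dot u (a *: v) = a * dot u v.
Proof. by rewrite dotC dotZl dotC. Qed.

Lemma dot_gt0 u : u != 0 -> 0 < dot u u.
Proof.
move=> u0; have [j uj] : exists j, u 0 j != 0.
  apply: contra_notP (negP u0) => /forallNP uj.
  by apply/eqP/rowP => j; rewrite [RHS]mxE; apply/eqP/negPn/negP/uj.
rewrite /dot (bigD1 j) //= ltr_wpDr //.
  by apply: sumr_ge0 => i _; rewrite -expr2 sqr_ge0.
by rewrite -expr2 exprn_even_gt0.
Qed.

Lemma continuous_at_dot (T : topologicalType) (x : T) (f h : T -> 'rV[R]_n) :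
  continuous_at x f -> continuous_at x h -> continuous_at x (fun y => dot (f y) (h y)).
Proof.
move=> fc hc; apply: continuous_at_sum => j _ /=.
by apply: continuous_atM; exact: continuous_at_coord.
Qed.

(** If u P' = 0 then u = u (P - P'), so the l^1 norm [S] of [u] satisfies S <= S n / (n + 1) and is
    zero. The bound 1 / (n + 1) is chosen to make this factor less than 1, also for n = 0. *)
Lemma near_fixed_neq0 u (P P' : 'M[R]_n) :
  (forall a b, `|P a b - P' a b| < n.+1%:R^-1) ->
  u *m P = u -> u != 0 -> u *m P' != 0.
Proof.
move=> PP' uP; apply: contra => /eqP uP'.
have uE j : u 0 j = \sum_a u 0 a * (P a j - P' a j).
  have /rowP/(_ j) : u *m (P - P') = u by rewrite mulmxBr uP uP' subr0.
  by rewrite mxE => <-; apply: eq_bigr => a _; rewrite !mxE.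
pose S := \sum_j `|u 0 j|.
have S0 : 0 <= S by exact: sumr_ge0.
have : S <= S * (n%:R / n.+1%:R).
  rewrite {1}/S (_ : S * _ = \sum_(j < n) S / n.+1%:R); last first.
    by rewrite sumr_const card_ord -[RHS]mulr_natr mulrA mulrAC.
  apply: ler_sum => j _; rewrite {1}uE; apply: le_trans (ler_norm_sum _ _ _) _.
  rewrite mulr_suml; apply: ler_sum => a _.
  by rewrite normrM ler_wpM2l // ltW.
rewrite -subr_le0 -{1}[S]mulr1 -mulrBr => SS.
have c0 : 0 < 1 - n%:R / n.+1%:R :> R.
  by rewrite subr_gt0 ltr_pdivrMr ?ltr0n // mul1r ltr_nat.
have SS0 : S <= 0 by rewrite -(pmulr_lle0 S c0).
have {SS S0 SS0} : S == 0 by rewrite eq_le SS0 S0.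
rewrite /S psumr_eq0 // => /allP u0; apply/eqP/rowP => j; rewrite mxE.
by apply/eqP; rewrite -normr_eq0; apply: u0; rewrite mem_index_enum.
Qed.

End Dot.

(** The line over [x] is the space of row vectors fixed by the idempotent [P x]; the last two
    conditions say that its dimension is 1. *)
Definition line_field (R : realType) (X : topologicalType) n (P : X -> 'M[R]_n) : Prop :=
  [/\ continuous P,
      forall x, P x *m P x = P x,
      forall x, exists2 v : 'rV[R]_n, v != 0 & v *m P x = v &
      forall x (u v : 'rV[R]_n), u *m P x = u -> v *m P x = v -> v != 0 ->
        exists a, u = a *: v].

(** A nowhere zero section of the lines pulled back along [f]: used with [f] a singular simplex, and
    with [f = id] for the global section. *)
Definition line_section (R : realType) (X Y : topologicalType) n (P : X -> 'M[R]_n)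
    (f : Y -> X) (u : Y -> 'rV[R]_n) : Prop :=
  continuous u /\ forall y, u y != 0 /\ u y *m P (f y) = u y.

Lemma line_section_comp (R : realType) (X Y Z : topologicalType) n (P : X -> 'M[R]_n)
    (f : Y -> X) (u : Y -> 'rV[R]_n) (h : Z -> Y) :
  line_section P f u -> continuous h -> line_section P (f \o h) (u \o h).
Proof.
move=> [uc uP] hc; split=> [z|z]; last exact: uP.
by apply: continuous_comp; [exact: hc | exact: uc].
Qed.

(* A vector at the first vertex is moved to [x] along the segment, projecting
   it to the line of the next of [N] equidistant points at each step. *)
Lemma simplex_line_section (R : realType) (X : topologicalType) n
    (P : X -> 'M[R]_n) m (s : simplex R X m) :
  line_field P -> exists u, line_section P s u.
Proof.
move=> [Pc PP Pex _]; set K := std_simplex R m.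
pose f (z : K * R) : 'M[R]_n := P (s (segment (vertex ord0) z.1 z.2)).
have fc : continuous f.
  move=> z; apply: (@continuous_comp _ _ _
    (fun z : K * R => segment (vertex ord0) z.1 z.2) (P \o s)).
    exact: segment_continuous.
  by apply: continuous_comp; [exact: cts_fun | exact: Pc].
have [N N0 fN] : exists2 N : nat, (0 < N)%N & forall y t t', 0 <= t <= 1 ->
    `|t - t'| <= N%:R^-1 -> forall a b, `|f (y, t) a b - f (y, t') a b| < n.+1%:R^-1.
  have : \forall r \near 0^'+, forall a b : 'I_n, forall y t t', 0 <= t <= 1 ->
      `|t - t'| < r -> `|f (y, t) a b - f (y, t') a b| < n.+1%:R^-1.
    apply: filter_forall => a; apply: filter_forall => b.
    apply: (@uniformly_continuous_on_compact R K (fun z => f z a b)).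
    - exact: compact_simplexT.
    - by move=> z; apply: continuous_at_coord; exact: fc.
    - by rewrite invr_gt0 ltr0n.
  move=> fr.
  have [r [r0 {}fr]] := filter_ex (filterI (nbhs_right_gt 0) fr).
  have [N Nr] := ltr_add_invr (y := 0) (x := r) r0.
  exists N.+1 => // y t t' t01 tt' a b; apply: fr => //.
  by apply: le_lt_trans tt' _; rewrite -[ltLHS]add0r.
have [v v0 vP] := Pex (s (vertex ord0)).
(* After [j] projections the vector over [y] lies in the line at parameter [j / N] of the segment to
   [y]; parameter 1 is [y] itself. *)
suff /(_ N (leqnn N)) [u [uc uP]] : forall j, (j <= N)%N -> exists u : K -> 'rV[R]_n,
    continuous u /\ forall y, u y != 0 /\ u y *m f (y, j%:R / N%:R) = u y.
  exists u; split=> // y; have [uy0 uPy] := uP y; split=> //.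
  by move: uPy; rewrite /f divff ?pnatr_eq0 -?lt0n //= segment1.
elim=> [_|j IHj jN].
  exists (fun=> v); split=> [y|y]; first by apply: cst_continuous.
  by rewrite mul0r /f /= segment0.
have [u [uc uP]] := IHj (ltnW jN).
exists (fun y => u y *m f (y, j.+1%:R / N%:R)); split=> y.
  apply: continuous_at_mulmx; first exact: uc.
  apply: (@continuous_comp _ _ _ (fun y : K => (y, j.+1%:R / N%:R : R)) f); last exact: fc.
  move=> U [[A B] [/= Ay Bt] ABU]; apply: (filterS _ Ay) => y' Ay'.
  by apply: ABU; split=> //=; exact: nbhs_singleton Bt.
have [uy0 uPy] := uP y; split; last by rewrite -mulmxA PP.
have Np : 0 < N%:R :> R by rewrite ltr0n.
apply: near_fixed_neq0 uPy uy0; apply: fN.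
  by rewrite divr_ge0 ?ler0n //= ler_pdivrMr // mul1r ler_nat ltnW.
by rewrite distrC -mulrBl -natrB // subSnn mul1r gtr0_norm ?invr_gt0.
Qed.

Section Sign.
Context {R : realType} {X : topologicalType} {n : nat} (P : X -> 'M[R]_n).
Hypothesis Plf : line_field P.

Lemma dot_line_neq0 x u v : u *m P x = u -> v *m P x = v -> u != 0 -> v != 0 ->
  dot u v != 0.
Proof.
move=> uP vP u0 v0; have [_ _ _ /(_ x u v uP vP v0)[a uE]] := Plf.
rewrite uE dotZl mulf_neq0 //; last by rewrite gt_eqF // dot_gt0.
by move: u0; rewrite uE scaler_eq0 (negPf v0) orbF.
Qed.

(** Vectors of one line are multiples of each other, so signs of dot products multiply; equality of
    booleans encodes the product of signs. *)
Lemma dot_line_sign x u v w : u *m P x = u -> v *m P x = v -> w *m P x = w ->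
  u != 0 -> v != 0 -> w != 0 -> (0 < dot u w) = ((0 < dot u v) == (0 < dot v w)).
Proof.
move=> uP vP wP u0 v0 w0; have [_ _ _ Pl] := Plf.
have [a uE] := Pl x u v uP vP v0; have [b wE] := Pl x w v wP vP v0.
have a0 : a != 0 by move: u0; rewrite uE scaler_eq0 (negPf v0) orbF.
have b0 : b != 0 by move: w0; rewrite wE scaler_eq0 (negPf v0) orbF.
rewrite uE wE !dotZl !dotZr mulrA !(pmulr_lgt0 _ (dot_gt0 v0)).
have [a1|a1|a1] := ltrgt0P a; last by rewrite a1 eqxx in a0.
  by rewrite pmulr_rgt0 // eq_sym eqb_id.
rewrite nmulr_rgt0 //; have [b1|b1|b1] := ltrgt0P b => //.
by rewrite b1 eqxx in b0.
Qed.

(** The dot product of two nonzero vectors of one line is nonzero, so along the path it cannot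
    change sign, by the intermediate value theorem. *)
Lemma path_dot_sign (g : simplex R X 1) u v :
  line_section P g u -> line_section P g v ->
  (0 < dot (u (vertex ord0)) (v (vertex ord0))) =
  (0 < dot (u (vertex ord_max)) (v (vertex ord_max))).
Proof.
move=> [uc uP] [vc vP]; pose a : std_simplex R 1 := vertex ord0.
pose b : std_simplex R 1 := vertex ord_max.
pose h t := dot (u (segment a b t)) (v (segment a b t)) : R.
have hc : continuous h.
  move=> t; apply: continuous_at_dot.
    by apply: (@continuous_comp _ _ _ (segment a b) u);
       [exact: segment_continuousr | exact: uc].
  by apply: (@continuous_comp _ _ _ (segment a b) v);
     [exact: segment_continuousr | exact: vc].
have h0 t : h t != 0.
  have [u0 ?] := uP (segment a b t); have [v0 ?] := vP (segment a b t).
  exact: (@dot_line_neq0 (g (segment a b t))).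
have IV : ~ (Num.min (h 0) (h 1) <= 0 <= Num.max (h 0) (h 1)).
  move=> hm; have [c _ hc0] := IVT ler01 (continuous_subspaceT hc) hm.
  by have := h0 c; rewrite hc0 eqxx.
have <- : h 0 = dot (u a) (v a) by rewrite /h segment0.
have <- : h 1 = dot (u b) (v b) by rewrite /h segment1.
apply/idP/idP => [h0p|h1p]; rewrite lt_neqAle eq_sym h0 /= leNgt; apply/negP => hn; apply: IV.
  by rewrite ge_min le_max (ltW h0p) (ltW hn) orbT.
by rewrite ge_min le_max (ltW h1p) (ltW hn) orbT.
Qed.

End Sign.

(** * Mod 2 chains and cocycles *)

Lemma face_vertex (R : realType) m (i : 'I_m.+2) (j : 'I_m.+1) :
  face i (vertex j) = vertex (lift i j) :> std_simplex R m.+1.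
Proof.
apply: val_inj; apply/rowP => a; rewrite /= !mxE eqxx /=.
case: (unliftP i a) => [a' ->|->]; first by rewrite mxE eqxx (inj_eq (@lift_inj _ i)).
by rewrite (negPf (neq_lift i j)).
Qed.

Lemma std_simplex0 (R : realType) (x : std_simplex R 0) : x = vertex ord0.
Proof.
have /set_mem[_ x1] := valP x; rewrite big_ord1 in x1.
by apply: val_inj; apply/rowP => j; rewrite (ord1 j) x1 mxE !eqxx.
Qed.

Section Mod2Chains.
Context {R : realType} {X : topologicalType}.

Lemma Z2_addrr (x : 'Z_2) : x + x = 0.
Proof. by apply/eqP; case: x => [[|[|]]]. Qed.

Lemma Z2_sign (x : 'Z_2) m : x *~ ((-1) ^+ m) = x.
Proof.
rewrite -signr_odd; case: (odd m) => //=; rewrite expr1 mulrN1z.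
by apply/eqP; rewrite -subr_eq0 -opprD Z2_addrr oppr0.
Qed.

Definition support m (c : simplex R X m -> 'Z_2) : {fset simplex R X m} :=
  fset_set [set s | c s != 0].

Lemma notin_support m (c : simplex R X m -> 'Z_2) s :
  is_chain c -> s \notin support c -> c s = 0.
Proof.
move=> cfin; rewrite in_fset_set // => /negP/negP; rewrite notin_setE /=.
by move/negP; rewrite negbK => /eqP.
Qed.

Lemma boundaryE m (c : simplex R X m.+1 -> 'Z_2) (A : {fset simplex R X m.+1}) t :
  (forall s, s \notin A -> c s = 0) ->
  boundary c t = \sum_(s <- A) \sum_(i < m.+2 | simplex_face s i == t) c s.
Proof.
move=> cA; rewrite /boundary (fsbigTE A) => [|s sA]; last first.
  by apply: big1 => i _; rewrite cA // mul0rz.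
by apply: eq_bigr => s _; apply: eq_bigr => i _; exact: Z2_sign.
Qed.

Definition pairing m (w c : simplex R X m -> 'Z_2) : 'Z_2 :=
  \sum_(t \in [set: simplex R X m]) w t * c t.

Lemma pairingE m (w c : simplex R X m -> 'Z_2) (A : {fset simplex R X m}) :
  (forall s, s \notin A -> c s = 0) -> pairing w c = \sum_(t <- A) w t * c t.
Proof. by move=> cA; rewrite /pairing (fsbigTE A) // => s /cA ->; rewrite mulr0. Qed.

(** Pairing with a boundary is pairing the coboundary of [w] with [c]. All sums are first restricted
    to the support [A] of [c] and the finite set [B] of faces of its simplices, so that they can be
    exchanged. *)
Lemma pairing_boundary m (w : simplex R X m -> 'Z_2) (c : simplex R X m.+1 -> 'Z_2) :
  (forall s : simplex R X m.+1, \sum_(i < m.+2) w (simplex_face s i) = 0) ->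
  is_chain c -> pairing w (boundary c) = 0.
Proof.
move=> w0 cfin; pose A := support c.
have cA s : s \notin A -> c s = 0 by exact: notin_support.
pose B := [fset simplex_face s i | s in A, i in [fset i | i : 'I_m.+2]%fset]%fset.
have faceB s i : s \in A -> simplex_face s i \in B.
  by move=> sA; apply/imfset2P; exists s => //; exists i => //; rewrite !inE.
have E t := boundaryE t cA.
rewrite (@pairingE _ _ _ B) => [|t tB]; last first.
  rewrite E big_seq big1 // => s sA; apply: big1 => i /eqP st.
  by rewrite -st faceB in tB.
under eq_bigr do rewrite E mulr_sumr.
rewrite exchange_big /= big_seq big1 // => s sA.
transitivity (\sum_(i < m.+2) w (simplex_face s i) * c s); last first.
  by rewrite -mulr_suml w0 mul0r.
under eq_bigr do rewrite mulr_sumr big_mkcond.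
rewrite exchange_big; apply: eq_bigr => i _ /=.
rewrite (bigD1_seq (simplex_face s i)) ?faceB ?fset_uniq //= eqxx.
by rewrite big1 ?addr0 // => t; rewrite eq_sym => /negPf ->.
Qed.

Lemma is_chainD m (c c' : simplex R X m -> 'Z_2) :
  is_chain c -> is_chain c' -> is_chain (fun s => c s + c' s).
Proof.
move=> cf cf'; apply: (@sub_finite_set _ _ ([set s | c s != 0] `|` [set s | c' s != 0])).
  by move=> s /=; have [->|] := eqVneq (c s) 0; [rewrite add0r; right | left].
by rewrite finite_setU.
Qed.

Lemma supportD m (c c' : simplex R X m -> 'Z_2) :
  is_chain c -> is_chain c' -> exists A : {fset simplex R X m},
  forall s, s \notin A -> c s = 0 /\ c' s = 0.
Proof.
move=> cf cf'; exists (support c `|` support c')%fset => s.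
by rewrite in_fsetU negb_or => /andP[/notin_support -> // /notin_support ->].
Qed.

Lemma pairingD m (w c c' : simplex R X m -> 'Z_2) :
  is_chain c -> is_chain c' ->
  pairing w (fun s => c s + c' s) = pairing w c + pairing w c'.
Proof.
move=> cf cf'; have [A cA] := supportD cf cf'.
rewrite !(@pairingE _ _ _ A) => [|s /cA[]|s /cA[]|s /cA[-> ->]] //; last exact: addr0.
by rewrite -big_split; apply: eq_bigr => s _; rewrite mulrDr.
Qed.

Lemma boundaryD m (c c' : simplex R X m.+1 -> 'Z_2) t :
  is_chain c -> is_chain c' ->
  boundary (fun s => c s + c' s) t = boundary c t + boundary c' t.
Proof.
move=> cf cf'; have [A cA] := supportD cf cf'.
rewrite !(@boundaryE _ _ A) => [|s /cA[]|s /cA[]|s /cA[-> ->]] //; last exact: addr0.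
by rewrite -big_split; apply: eq_bigr => s _; rewrite -big_split.
Qed.

Definition single m (g : simplex R X m) : simplex R X m -> 'Z_2 :=
  fun s => (s == g)%:R.

Lemma single_notin m (g s : simplex R X m) : s \notin [fset g]%fset -> single g s = 0.
Proof. by rewrite inE /single => /negPf ->. Qed.

Lemma is_chain_single m (g : simplex R X m) : is_chain (single g).
Proof.
apply: (@sub_finite_set _ _ [set g]); last exact: finite_set1.
by move=> s /=; rewrite /single; case: (s =P g) => // _; rewrite mulr0n eqxx.
Qed.

Lemma pairing_single m (w : simplex R X m -> 'Z_2) g : pairing w (single g) = w g.
Proof.
rewrite (@pairingE _ _ _ [fset g]%fset); last exact: single_notin.
by rewrite big_seq_fset1 /single eqxx mulr1.
Qed.

Definition point (p : X) : simplex R X 0 -> 'Z_2 := fun t => (t (vertex ord0) == p)%:R.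

Lemma boundary_single (g : simplex R X 1) t :
  boundary (single g) t = point (g (vertex ord0)) t + point (g (vertex ord_max)) t.
Proof.
rewrite (@boundaryE _ _ [fset g]%fset); last exact: single_notin.
rewrite big_seq_fset1 /single eqxx big_mkcond big_ord_recl big_ord1 addrC /=.
have faceE i : (simplex_face g i == t) = (t (vertex ord0) == g (vertex (lift i ord0))).
  rewrite -face_vertex; apply/eqP/eqP => [<- //|tg]; apply/continuousEP => x.
  by rewrite (std_simplex0 x) tg.
rewrite !faceE /point.
rewrite (_ : lift (lift ord0 ord0) ord0 = ord0 :> 'I_2); last exact: val_inj.
rewrite (_ : lift ord0 ord0 = ord_max :> 'I_2); last exact: val_inj.
by do 2 case: eqP.
Qed.

(* Points are compared through chains, not paths: [p ~ q] when [p + q] bounds a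
   mod 2 chain [c], and then the pairing of [w] with [c] only depends on [p] and
   [q] since [w] vanishes on cycles. *)
Lemma mod2_cocycle_coboundary (w : simplex R X 1 -> 'Z_2) :
  (forall s : simplex R X 2, \sum_(i < 3) w (simplex_face s i) = 0) ->
  homology_vanishes R X 'Z_2 1 ->
  exists h : X -> 'Z_2, forall g : simplex R X 1,
    w g = h (g (vertex ord0)) + h (g (vertex ord_max)).
Proof.
move=> w0 H1.
have w_cycle c : is_chain c -> (forall t, boundary c t = 0) -> pairing w c = 0.
  move=> cf c0; have [|b bf <-] := H1 c; last exact: pairing_boundary.
  by split=> //; apply/funext => t; exact: c0.
have [[x0]|X0] := pselect (inhabited X); last first.
  by exists (fun=> 0) => g; case: X0; split; exact: (g (vertex ord0)).
pose bounds p q (c : simplex R X 1 -> 'Z_2) :=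
  is_chain c /\ forall t, boundary c t = point p t + point q t.
have bounds_add p q r c c' : bounds p q c -> bounds r q c' ->
    bounds p r (fun s => c s + c' s).
  move=> [cf cE] [cf' cE']; split; first exact: is_chainD.
  by move=> t; rewrite boundaryD // cE cE' addrACA Z2_addrr addr0.
have boundsC p q c : bounds p q c -> bounds q p c.
  by move=> [cf cE]; split=> // t; rewrite cE addrC.
have bounds0 p : bounds p p (fun=> 0).
  have cf : is_chain (fun _ : simplex R X 1 => 0 : 'Z_2).
    by apply: (@sub_finite_set _ _ set0) => // s /=; rewrite eqxx.
  by split=> // t; rewrite (@boundaryE _ _ fset0) // big_seq_fset0 Z2_addrr.
(* A chosen base point in the class of [p]. Equivalent points define the same set, so [xget] gives
   them equal base points. *)
pose r p := xget x0 [set q | exists c, bounds p q c].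
have rP p : exists c, bounds p (r p) c.
  by apply: (@xgetPex _ x0 [set q | exists c, bounds p q c]); exists p, (fun=> 0).
have r_eq p q c : bounds p q c -> r p = r q.
  move=> pq; congr xget; apply/seteqP; split=> z /= [c' zc'].
    by exists (fun s => c s + c' s); apply: bounds_add (boundsC _ _ _ pq) (boundsC _ _ _ zc').
  by exists (fun s => c s + c' s); apply: bounds_add pq (boundsC _ _ _ zc').
have [b bP] := choice rP.
exists (fun p => pairing w (b p)) => g.
set p := g _; set q := g _.
have gpq : bounds p q (single g).
  by split; [exact: is_chain_single | exact: boundary_single].
have [pf pE] := bP p; have [qf qE] := bP q; have [gf gE] := gpq.
have rpq := r_eq _ _ _ gpq; rewrite -rpq in qE.
(* [b p] and [b q] lead from [p] and [q] to the same base point, so together with [g] they form a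
   cycle. *)
have := w_cycle (fun s => (b p s + b q s) + single g s).
rewrite !pairingD ?pairing_single //; last exact: is_chainD.
move=> c0; apply/eqP; rewrite -subr_eq0; apply/eqP.
rewrite -c0; first last.
- move=> t; rewrite !boundaryD //; last exact: is_chainD.
  by rewrite pE qE gE (addrACA (point p t)) Z2_addrr addr0 Z2_addrr.
- by apply: is_chainD => //; exact: is_chainD.
rewrite addrC; congr (_ + _).
by apply/eqP; rewrite eq_sym -subr_eq0 opprK Z2_addrr.
Qed.

End Mod2Chains.

(** * Global sections of fields of lines *)

Definition locally_path_connected (R : realType) (X : topologicalType) :=
  forall (x : X) (U : set X), nbhs x U -> \forall y \near x,
    exists g : simplex R X 1, [/\ g (vertex ord0) = x, g (vertex ord_max) = y &
      forall z, U (g z)].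

Section GlobalSection.
Context {R : realType} {X : topologicalType} {n : nat} (P : X -> 'M[R]_n).
Hypothesis Plf : line_field P.

Lemma unit_line_vectors : exists rho : X -> 'rV[R]_n, forall x,
  [/\ rho x != 0, rho x *m P x = rho x & dot (rho x) (rho x) = 1].
Proof.
have [_ _ Pex _] := Plf.
suff /choice[rho rhoP] : forall x, exists r : 'rV[R]_n,
    [/\ r != 0, r *m P x = r & dot r r = 1] by exists rho.
move=> x; have [v v0 vP] := Pex x; have vv := dot_gt0 v0.
have sv : 0 < Num.sqrt (dot v v) by rewrite sqrtr_gt0.
exists ((Num.sqrt (dot v v))^-1 *: v); split.
- by rewrite scaler_eq0 negb_or v0 invr_eq0 gt_eqF.
- by rewrite -scalemxAl vP.
- by rewrite dotZl dotZr mulrA -invfM -expr2 sqr_sqrtr ?ltW // mulVf ?gt_eqF.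
Qed.

(* The sign of a continuous nonzero section of the lines along a path, relative
   to the arbitrary choice [rho], changes by a factor which only depends on the
   path: the holonomy of the double cover of unit vectors. *)
Lemma holonomy (rho : X -> 'rV[R]_n) :
  (forall x, rho x != 0 /\ rho x *m P x = rho x) ->
  exists w : simplex R X 1 -> bool, forall (g : simplex R X 1) u,
    line_section P g u ->
    w g = (0 < dot (u (vertex ord0)) (rho (g (vertex ord0))))
      (+) (0 < dot (u (vertex ord_max)) (rho (g (vertex ord_max)))).
Proof.
move=> rhoP.
have [L LP] := choice (fun g : simplex R X 1 => simplex_line_section g Plf).
exists (fun g => (0 < dot (L g (vertex ord0)) (rho (g (vertex ord0))))
      (+) (0 < dot (L g (vertex ord_max)) (rho (g (vertex ord_max))))) => g u uP.
have signE (z : std_simplex R 1) : (0 < dot (L g z) (rho (g z))) =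
    ((0 < dot (L g z) (u z)) == (0 < dot (u z) (rho (g z)))).
  have [_ /(_ z)[L0 Lz]] := LP g; have [_ /(_ z)[u0 uz]] := uP.
  have [r0 rz] := rhoP (g z).
  exact: (dot_line_sign Plf (x := g z)).
(* Replacing [L g] by [u] changes the signs at both ends by the same factor, which the exclusive or
   does not see. *)
rewrite !signE (path_dot_sign Plf (LP g) uP).
by do 3 case: (0 < _).
Qed.

(** A section over a 2-simplex computes [w] on its three faces, which gives the cocycle condition.
    If [w] is the coboundary of [h], correcting [rho] by the sign (-1)^h cancels the holonomy of
    every path, in particular of short ones, whence continuity. *)
Theorem line_field_global_section :
  locally_path_connected R X -> homology_vanishes R X 'Z_2 1 ->
  exists v : X -> 'rV[R]_n, line_section P id v.
Proof.
move=> lpc H1; have [rho rhoP] := unit_line_vectors.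
have [|w wE] := @holonomy rho; first by move=> x; have [] := rhoP x.
have [|h hE] := mod2_cocycle_coboundary (w := fun g => (w g)%:R) _ H1.
  move=> s; have [u uP] := simplex_line_section s Plf.
  have wf i : w (simplex_face s i) =
      (0 < dot (u (vertex (lift i ord0))) (rho (s (vertex (lift i ord0)))))
      (+) (0 < dot (u (vertex (lift i ord_max))) (rho (s (vertex (lift i ord_max))))).
    rewrite (wE _ (u \o face i)); last first.
      by apply: line_section_comp uP _; exact: cts_fun.
    by rewrite /simplex_face /= !face_vertex.
  rewrite !big_ord_recr big_ord0 /= !wf add0r.
  (* Indexing vertices by naturals identifies those shared by two faces: each of the three signs
     then occurs twice. *)
  pose sg (j : nat) := 0 < dot (u (vertex (inord j))) (rho (s (vertex (inord j)))).
  have sgE (j : 'I_3) : (0 < dot (u (vertex j)) (rho (s (vertex j)))) = sg j.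
    by rewrite /sg inord_val.
  rewrite !sgE /= /bump /=.
  by case: (sg _); case: (sg _); case: (sg _); apply/eqP.
pose v x := (-1) ^+ (h x != 0) *: rho x.
have v0 x : v x != 0.
  by rewrite scaler_eq0 negb_or signr_eq0; have [] := rhoP x.
have vP x : v x *m P x = v x.
  by rewrite -scalemxAl; have [_ ->] := rhoP x.
exists v; split=> // x.
have [Pc PP _ Pl] := Plf.
(* Projecting the fixed vector [v x] to nearby lines gives a continuous section through [v x]. Near
   [x], [v] is shown to be its normalization. *)
pose l y := v x *m P y.
have lc : continuous l.
  by move=> y; apply: continuous_at_mulmx; [exact: cst_continuous | exact: Pc].
have lx : l x = v x by exact: vP.
have ll_gt0 : 0 < dot (l x) (l x) by rewrite dot_gt0 // lx.
have llc y : continuous_at y (fun y => dot (l y) (l y)).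
  by apply: continuous_at_dot; exact: lc.
have near_l : \forall y \near x, l y != 0.
  have : \forall y \near x, 0 < dot (l y) (l y) by exact: (cvgr_gt _ (llc x)).
  apply: filterS => y; apply: contraTneq => ->.
  by rewrite /dot big1 ?ltxx // => j _; rewrite mxE mul0r.
apply: (@continuous_at_near _ _ x (fun y => (Num.sqrt (dot (l y) (l y)))^-1 *: l y)).
  apply: continuous_at_scale; last exact: lc.
  apply: continuous_atV; first by rewrite gt_eqF // sqrtr_gt0.
  by apply: continuous_comp; [exact: llc | exact: sqrt_continuous].
have := lpc x _ near_l; apply: filterS => y [g [gx gy gl]].
have ly0 : l y != 0 by rewrite -gy; exact: gl.
have lsec : line_section P g (l \o g).
  split=> [z|z]; first by apply: continuous_comp; [exact: cts_fun | exact: lc].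
  by split; [exact: gl | rewrite /= /l -mulmxA PP].
have [ry0 ryP ry1] := rhoP y; have [rx0 rxP rx1] := rhoP x.
have lyP : l y *m P y = l y by rewrite /l -mulmxA PP.
have [a lyE] := Pl _ _ _ lyP ryP ry0.
have a0 : a != 0 by apply: contraNneq ly0 => a0; rewrite lyE a0 scale0r.
have := hE g; rewrite (wE g _ lsec) /= gx gy lx lyE /v !dotZl rx1 ry1 !mulr1.
rewrite signr_gt0 => hxy.
(* At [x] the sign of [l] relative to [rho] is (-1)^(h x), and [w g] is [h x + h y]; hence at [y] it
   is (-1)^(h y). *)
have ha : (0 < a) = (h y == 0).
  move: hxy; case: (0 < a) => //; case: (h x) => [[|[|?]] ?] //;
  case: (h y) => [[|[|?]] ?] //.
rewrite dotZr ry1 mulr1 -expr2 sqrtr_sqr scalerA.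
congr (_ *: _); rewrite -ha.
have [a1|a1|a1] := ltrgt0P a; last by rewrite a1 eqxx in a0.
  by rewrite mulVf // gt_eqF.
by rewrite invrN mulNr mulVf // lt_eqF.
Qed.

End GlobalSection.

(** The powers of X let [lam] list the eigenvalues of the frame operator, of size k, while [G] is
    the Gram matrix, of size n: sorting and simplicity are known for the former, the lines are those
    of the latter. *)
Theorem eigen_line_field (R : realType) (X : topologicalType) n k a b
    (G : X -> 'M[R]_n) (lam : X -> 'I_k -> R) (i : 'I_k) :
  continuous G ->
  (forall x (j l : 'I_k), (j <= l)%N -> lam x l <= lam x j) ->
  (forall x, 'X^a * roots_poly (lam x) = 'X^b * char_poly (G x)) ->
  (forall x, lam x i != 0) ->
  (forall x j, lam x j = lam x i -> j = i) ->
  exists P : X -> 'M[R]_n, line_field P /\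
    forall x (v : 'rV[R]_n), v *m P x = v -> v *m G x = lam x i *: v.
Proof.
move=> Gc lam_sorted lamE lam0 lam_simple.
have charc x : coef_continuous_at x (fun y => char_poly (G y)).
  exact: coef_continuous_at_char_poly.
have lamc x : continuous_at x (fun y => lam y i).
  apply: continuous_at_sorted_root => // m.
  have -> : (fun y => (roots_poly (lam y))`_m) =
      (fun y => ('X^b * char_poly (G y))`_(m + a)).
    by apply/funext => y; rewrite -lamE coefXnM ltnNge leq_addl /= addnK.
  by apply: coef_continuous_atM => //; exact: coef_continuous_at_cst.
have /choice[h hP] : forall x, exists p : {poly R},
    char_poly (G x) = ('X - (lam x i)%:P) * p /\ p.[lam x i] != 0.
  by move=> x; have [p pE p0] := simple_root_factor (lamE x) (lam0 x) (lam_simple x); exists p.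
have hsize x : (size (h x) <= n.+1)%N.
  have [hE hl] := hP x; have h0 : h x != 0.
    by apply: contraNneq hl => ->; rewrite horner0.
  have := size_char_poly (G x).
  rewrite hE mulrC size_Mmonic ?monicXsubC // size_XsubC addn2 /= => <-.
  exact: leqnSn.
(* [h] was chosen pointwise, but as a quotient by a monic factor it is determined, and continuous by
   deflation. *)
have hc x : coef_continuous_at x h.
  by apply: (coef_continuous_at_deflation hsize _ (lamc x) (charc x)) => y; have [] := hP y.
have hlc x : continuous_at x (fun y => (h y).[lam y i]).
  have -> : (fun y => (h y).[lam y i]) =
      (fun y => \sum_(m < n.+1) (h y)`_m * lam y i ^+ m).
    by apply/funext => y; rewrite (horner_coef_wide _ (hsize y)).
  apply: continuous_at_sum => m _ /=; apply: continuous_atM; first exact: hc.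
  have -> : (fun y => lam y i ^+ m) = (fun y => \prod_(j < m) lam y i).
    by apply/funext => y; rewrite prodr_const card_ord.
  by apply: continuous_at_prod.
exists (fun x => eigenprojector (G x) (lam x i) (h x)).
have Pfix x := @eigenprojector_fix _ _ (G x) (lam x i) (h x) (proj1 (hP x)) (proj2 (hP x)).
have Peig x := @eigenprojector_eigen _ _ (G x) (lam x i) (h x) (proj1 (hP x)).
have Pline x (v : 'rV[R]_n) :
    v *m eigenprojector (G x) (lam x i) (h x) = v -> v *m G x = lam x i *: v.
  by move=> vP; have := Peig x v; rewrite vP.
split=> //; split=> [x|x|x|x u v uP vP v0].
- apply: continuous_at_scale.
    by apply: continuous_atV; [have [] := hP x | exact: hlc].
  apply: continuous_at_adj; apply: continuous_at_mx => j l.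
  have -> : (fun y => ((lam y i)%:M - G y) j l) =
      (fun y => lam y i *+ (j == l) - G y j l) by apply/funext => y; rewrite !mxE.
  apply: continuous_atB; last by apply: continuous_at_coord; exact: Gc.
  by case: (j == l); [exact: lamc | exact: cst_continuous].
- by apply/row_matrixP => j; rewrite row_mul Pfix // rowE Peig.
- have : eigenvalue (G x) (lam x i).
    rewrite eigenvalue_root_char; have [-> _] := hP x.
    by rewrite rootM root_XsubC eqxx.
  by move=> /eigenvalueP[v vG v0]; exists v => //; exact: Pfix.
- have [hE hl] := hP x.
  by apply: (eigenvector_unique hE hl) => //; exact: Pline.
Qed.

(** * Manifolds and frame operators *)

Section ManifoldTopology.
Context {R : realType} {d : nat} (M : manifold R d).

Lemma smooth_fun_continuous_at (U : set M) (f : M -> R) p :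
  open U -> smooth_fun U f -> U p -> continuous_at p f.
Proof.
move=> oU fs Up; have [c cA cp] := atlas_cover p.
have [odom oim cK map_c inv_c] := atlas_chart cA.
have /(_ 0%N)[fc _] := fs _ cA.
set V := chart_map c @` _ in fc.
have near_dom : \forall q \near p, (U `&` chart_dom c) q.
  by apply: open_nbhs_nbhs; split=> //; exact: openI.
have Vp : V (chart_map c p) by exists p.
have {}fc : (f \o chart_inv c) @ within V (nbhs (chart_map c p)) --> f p.
  have fpE : (f \o chart_inv c) (chart_map c p) = f p by rewrite /= cK ?mem_set.
  by rewrite -[X in _ --> X]fpE; move/subspace_continuousP: fc; apply.
have mapc : chart_map c @ p --> within V (nbhs (chart_map c p)).
  move=> W WV.
  have mc := within_open_continuous_at odom map_c cp.
  have mW : \forall q \near p, V (chart_map c q) -> W (chart_map c q).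
    exact: (mc _ WV).
  by apply: filterS2 near_dom mW => q Uq; apply; exists q.
apply: (@cvg_trans _ ((f \o chart_inv c) (chart_map c q) @[q --> p])).
  apply: near_eq_cvg; apply: filterS near_dom => q [_ cq] /=.
  by rewrite cK ?mem_set.
exact: cvg_comp mapc fc.
Qed.

(** In a chart, a straight segment from the centre of a ball stays in the ball, which is taken small
    enough for its image to lie in [U]. *)
Lemma manifold_locally_path_connected : locally_path_connected R M.
Proof.
move=> x U Ux; have [c cA cx] := atlas_cover x.
have [odom oim cK map_c inv_c] := atlas_chart cA.
set V := _ @` _ in oim inv_c; set x0 := chart_map c x.
have Vx0 : V x0 by exists x.
have invK q : chart_dom c q -> chart_inv c (chart_map c q) = q.
  by move=> cq; rewrite cK ?mem_set.
have : \forall z \near x0, V z /\ U (chart_inv c z).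
  apply: filterI; first by apply: open_nbhs_nbhs.
  have := within_open_continuous_at oim inv_c Vx0; apply.
  by rewrite /x0 invK.
move=> /nbhs_ballP[r /= r0 rU].
have map_near : \forall y \near x, ball x0 r (chart_map c y).
  have xb : nbhs x0 (ball x0 r) by exact: nbhsx_ballx.
  exact: (within_open_continuous_at odom map_c cx xb).
have dom_near : \forall y \near x, chart_dom c y by exact: open_nbhs_nbhs.
apply: filterS2 map_near dom_near => y yr cy.
pose tau (z : std_simplex R 1) : R := (\val z : 'rV[R]_2) 0 ord_max.
pose s z : 'rV[R]_d := x0 + tau z *: (chart_map c y - x0).
have sr z : ball x0 r (s z).
  have /set_mem[z0 z1] := valP z.
  have t0 : 0 <= tau z by exact: z0.
  have t1 : tau z <= 1 by rewrite -z1 big_ord_recr /= lerDr sumr_ge0.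
  rewrite -ball_normE /= /s opprD addrA subrr sub0r normrN normrZ ger0_norm //.
  move: yr; rewrite -ball_normE /= distrC; apply: le_lt_trans.
  by rewrite -[leRHS]mul1r ler_wpM2r.
have sc : continuous s.
  move=> z; have tc : continuous_at z (fun z => tau z *: (chart_map c y - x0)).
    apply: continuous_at_scale; last exact: cst_continuous.
    by apply: continuous_at_coord; exact: simplex_val_continuous.
  exact: (cvgD (cvg_cst _) tc).
have gc : continuous (chart_inv c \o s).
  move=> z; apply: continuous_comp; first exact: sc.
  by apply: within_open_continuous_at oim inv_c _; have [] := rU _ (sr z).
exists (mkcts gc); split=> [||z].
- have t0 : tau (vertex ord0) = 0 by rewrite /tau mxE.
  by rewrite -[LHS]/(chart_inv c (s (vertex ord0))) /s t0 scale0r addr0 invK.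
- have t1 : tau (vertex ord_max) = 1 by rewrite /tau mxE.
  by rewrite -[LHS]/(chart_inv c (s (vertex ord_max))) /s t1 scale1r addrC subrK invK.
- by have [] := rU _ (sr z).
Qed.

End ManifoldTopology.

(** * The frame operator and the Gram matrix of a frame *)

Section FrameOperator.
Context {R : realType} {n : nat} {V : vectType R} (g : V -> V -> R).
Hypothesis gP : inner_product g.

Lemma inner_productC u v : g u v = g v u.
Proof. by have [] := gP. Qed.

Lemma inner_product0l w : g 0 w = 0.
Proof.
have [_ gl _] := gP; have := gl 1 0 0 w.
by rewrite scaler0 addr0 mul1r => /eqP; rewrite -subr_eq0 opprD addNKr oppr_eq0 => /eqP.
Qed.

Lemma inner_product_suml (I : Type) (r : seq I) (c : I -> R) (u : I -> V) w :
  g (\sum_(i <- r) c i *: u i) w = \sum_(i <- r) c i * g (u i) w.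
Proof.
have [_ gl _] := gP.
elim: r => [|i r IHr]; first by rewrite !big_nil inner_product0l.
by rewrite !big_cons gl IHr.
Qed.

Variable A : 'Hom('rV[R]_n, V).
Hypothesis A_surj : limg A = fullv.

Lemma adjointE v : adjoint g A v = \row_(j < n) g (A (delta_mx 0 j)) v.
Proof.
have gr u : linear (g u : V -> R^o).
  have [gC gl _] := gP.
  by move=> a y z; rewrite gC gl [g y u]gC [g z u]gC.
pose f v : 'rV[R]_n := \row_(j < n) g (A (delta_mx 0 j)) v.
have flin : linear f by move=> a y z; apply/rowP => j; rewrite !mxE gr.
pose F : {linear V -> 'rV[R]_n} := HB.pack f (GRing.isLinear.Build _ _ _ _ f flin).
by rewrite /adjoint -[linfun _]/(linfun F) lfunE.
Qed.

Definition gram : 'M[R]_n := \matrix_(j, l) g (A (delta_mx 0 j)) (A (delta_mx 0 l)).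

Lemma hom_row_sum (x : 'rV[R]_n) : A x = \sum_j x 0 j *: A (delta_mx 0 j).
Proof.
rewrite {1}[x]row_sum_delta linear_sum; apply: eq_bigr => j _.
by rewrite linearZ.
Qed.

Lemma gram_mulE (v : 'rV[R]_n) l : (v *m gram) 0 l = g (A v) (A (delta_mx 0 l)).
Proof.
rewrite hom_row_sum inner_product_suml mxE.
by apply: eq_bigr => j _; rewrite mxE.
Qed.

Lemma gram_eigen_neq0 (v : 'rV[R]_n) l :
  v *m gram = l *: v -> l != 0 -> v != 0 -> A v != 0.
Proof.
move=> vG l0; apply: contra => /eqP Av; apply/eqP/(scalerI l0).
rewrite scaler0 -vG; apply/rowP => j.
by rewrite gram_mulE Av inner_product0l mxE.
Qed.

Local Notation b := (vbasis (fullv : {vspace V})).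

(** In a basis of [V] the adjoint has matrix [N] and [A] has matrix [Q]. Matrices act on rows, so
    the frame operator is [N *m Q], and [Q *m N] is the Gram matrix. *)
Lemma char_poly_frame_operator :
  'X^n * char_poly (mxof b b (frame_operator g A)) =
  'X^(\dim (fullv : {vspace V})) * char_poly gram.
Proof.
have bP : basis_of fullv b := vbasisP fullv.
pose N := \matrix_(a < \dim (fullv : {vspace V})) adjoint g A b`_a.
pose Q := \matrix_(j < n) rVof b (A (delta_mx 0 j)).
have -> : mxof b b (frame_operator g A) = N *m Q.
  apply/row_matrixP => a; rewrite row_mul rowK rowE.
  rewrite mul_mxof vecof_delta /frame_operator comp_lfunE.
  rewrite hom_row_sum. rewrite linear_sum.
  by rewrite mulmx_sum_row; apply: eq_bigr => j _; rewrite linearZ rowK.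
rewrite char_poly_mulmxC; congr (_ * char_poly _).
apply/matrixP => j l; rewrite !mxE inner_productC.
rewrite [A (delta_mx 0 j) in RHS](coord_basis bP) ?memvf // inner_productC.
rewrite inner_product_suml; apply: eq_bigr => a _.
by rewrite !mxE adjointE mxE inner_productC.
Qed.

(** If [e] is killed by the frame operator, then g(A A^T e, e) is the squared norm of A^T e, so A^T
    e = 0. Surjectivity gives e = A x, and g(e, e) is the dot product of x and A^T e, which is 0. *)
Lemma frame_operator_eigen_neq0 :
  ~~ root (char_poly (mxof b b (frame_operator g A))) 0.
Proof.
have bP : basis_of fullv b := vbasisP fullv.
rewrite -eigenvalue_root_char; apply/negP => /eigenvalueP[v].
rewrite scale0r => vS; pose e := vecof b v.
have : frame_operator g A e = 0.
  by rewrite (hom_vecof _ bP) vS linear0.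
rewrite /frame_operator comp_lfunE => Ae.
have adj0 : adjoint g A e = 0.
  have := adjointP A (adjoint g A e) e gP; rewrite Ae inner_product0l => /eqP.
  rewrite psumr_eq0 => [/allP s0|j _]; last by rewrite -expr2 sqr_ge0.
  apply/rowP => j; rewrite [RHS]mxE.
  by apply/eqP; have := s0 j (mem_index_enum _); rewrite mulf_eq0 orbb.
have [e0|e0] := eqVneq e 0.
  by rewrite -(vecofK bP v) -/e e0 linear0 eqxx.
have [x _ xe] : exists2 x, x \in fullv & e = A x.
  by apply/memv_imgP; rewrite A_surj memvf.
have := adjointP A x e gP; rewrite adj0 -xe => ee.
have [_ _ /(_ e e0)] := gP.
by rewrite -ee big1 ?ltxx // => j _; rewrite mxE mulr0.
Qed.

End FrameOperator.

(** * Homotopy invariance of singular cohomology *)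

(** The cancellation in the prism formula, over naturals to ease index shifts. [U i l] stands for
    the l-th face of the i-th simplex of the prism, [T j i] for the i-th simplex of the prism on the
    j-th face, and [D] for the walls between consecutive simplices, which telescope to the two
    ends. *)
Lemma prism_sum (A : zmodType) (N : nat) (T U : nat -> nat -> A) (D : nat -> A) :
  (forall i l, (i <= N)%N -> (l < i)%N -> U i l = T l i.-1) ->
  (forall i, (i <= N)%N -> U i i = D i) ->
  (forall i, (i <= N)%N -> U i i.+1 = D i.+1) ->
  (forall i l, (i <= N)%N -> (i.+1 < l)%N -> (l < N.+2)%N -> U i l = T l.-1 i) ->
  \sum_(0 <= i < N.+1) \sum_(0 <= l < N.+2) U i l *~ (-1) ^+ (i + l) =
  D 0%N - D N.+1 - \sum_(0 <= j < N.+1) \sum_(0 <= i < N) T j i *~ (-1) ^+ (j + i).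
Proof.
move=> Ult Ueq Uslt Ugt.
(* For fixed [i], the terms [T j i] split into those with j <= i, in [a i], and those with j > i, in
   [b i]. *)
pose a i := \sum_(0 <= l < i.+1) T l i *~ (-1) ^+ (l + i).
pose b i := \sum_(i.+1 <= j < N.+1) T j i *~ (-1) ^+ (j + i).
have row i : (i <= N)%N -> \sum_(0 <= l < N.+2) U i l *~ (-1) ^+ (i + l) =
    (if i is i'.+1 then - a i' else 0) + (D i - D i.+1) - b i.
  move=> iN; rewrite (@big_cat_nat _ _ _ i) //=; last by lia.
  rewrite -addrA; congr (_ + _).
    case: i iN => [|i] iN; first by rewrite big_geq.
    rewrite /a -sumrN; apply: eq_big_nat => l /andP[_ li].
    by rewrite Ult //= addSn exprS mulN1r mulrNz addnC.
  rewrite big_ltn; last by lia.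
  rewrite big_ltn; last by lia.
  rewrite Ueq // Uslt // addrA; congr (_ + _); first congr (_ + _).
  - by rewrite addnn -signr_odd odd_double.
  - by rewrite addnS exprS addnn -signr_odd odd_double mulr1 mulrN1z.
  rewrite -sumrN /b big_add1 /=; apply: eq_big_nat => l /andP[il lN].
  by rewrite Ugt //= addnS exprS mulN1r mulrNz addnC.
have bN : b N = 0 by rewrite /b big_geq.
transitivity (\sum_(0 <= i < N.+1) ((if i is i'.+1 then - a i' else 0) + (D i - D i.+1) - b i)).
  by apply: eq_big_nat => i /andP[_ iN]; apply: row.
rewrite big_split big_split /= sumrN.
have -> : \sum_(0 <= i < N.+1) (D i - D i.+1) = D 0%N - D N.+1.
  elim: (N.+1) => [|m IHm]; first by rewrite big_geq // subrr.
  by rewrite big_nat_recr //= IHm addrA subrK.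
rewrite [X in _ - X]big_nat_recr //= bN addr0 big_nat_recl //= add0r sumrN.
rewrite addrAC -opprD addrC; congr (_ - _).
rewrite exchange_big /= -big_split; apply: eq_big_nat => i /andP[_ iN] /=.
by rewrite /a /b -big_cat_nat //=; lia.
Qed.

(** * Affine maps between simplices induced by maps of vertices *)

Section PushForward.
Context {R : realType}.

Lemma sum_face_row m (th : 'I_m.+1 -> bool) (l : 'I_m.+2) (q : 'I_m.+2 -> bool) (x : 'rV[R]_m.+1) :
  (forall a, th a = q (lift l a)) ->
  \sum_(a | q a) face_row l x 0 a = \sum_(a | th a) x 0 a.
Proof.
move=> thq; rewrite big_mkcond (bigD1_ord l) //= mxE unlift_none if_same add0r.
rewrite [RHS]big_mkcond; apply: eq_bigr => a _.
by rewrite mxE liftK thq.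
Qed.

Definition push_row m p (th : 'I_m.+1 -> 'I_p.+1) (x : 'rV[R]_m.+1) : 'rV[R]_p.+1 :=
  \row_j \sum_(a | th a == j) x 0 a.

Lemma push_subproof m p (th : 'I_m.+1 -> 'I_p.+1) (x : std_simplex R m) :
  push_row th (\val x) \in std_simplex R p.
Proof.
have /set_mem[x0 x1] := valP x; apply/mem_set; split=> [j|].
  by rewrite mxE sumr_ge0.
rewrite -x1 [RHS](partition_big th xpredT) //=.
by apply: eq_bigr => j _; rewrite mxE.
Qed.

Definition push m p (th : 'I_m.+1 -> 'I_p.+1) (x : std_simplex R m) : std_simplex R p :=
  exist _ (push_row th (\val x)) (push_subproof th x).

Lemma push_continuous m p (th : 'I_m.+1 -> 'I_p.+1) : continuous (push th).
Proof.
apply: to_simplex_continuous => x; apply: continuous_at_mx => i j.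
have -> : (fun y => (\val (push th y) : 'rV[R]_p.+1) i j) =
    (fun y => \sum_(a | th a == j) (\val y : 'rV[R]_m.+1) 0 a).
  by apply/funext => y; rewrite /= mxE.
apply: continuous_at_sum => a _.
by apply: continuous_at_coord; exact: simplex_val_continuous.
Qed.

Lemma push_face m p (th : 'I_m.+2 -> 'I_p.+1) l (x : std_simplex R m) :
  push th (face l x) = push (th \o lift l) x.
Proof.
apply: val_inj; apply/rowP => j; rewrite /= !mxE.
exact: sum_face_row.
Qed.

Lemma face_push m p (th : 'I_m.+1 -> 'I_p.+1) l (x : std_simplex R m) :
  face l (push th x) = push (lift l \o th) x.
Proof.
apply: val_inj; apply/rowP => j; rewrite /= !mxE.
case: (unliftP l j) => [j' ->|->].
  by rewrite mxE; apply: eq_bigl => a; rewrite (inj_eq (@lift_inj _ l)).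
by rewrite big_pred0 // => a /=; rewrite eq_sym (negPf (neq_lift l (th a))).
Qed.

Lemma push_id m (x : std_simplex R m) : push id x = x.
Proof. by apply: val_inj; apply/rowP => j; rewrite mxE big_pred1_eq. Qed.

(** The affine function equal to 1 at the vertices in [q] and 0 at the others: the height coordinate
    of the prism. *)
Definition level m (q : 'I_m.+1 -> bool) (x : std_simplex R m) : R :=
  \sum_(a | q a) (\val x : 'rV[R]_m.+1) 0 a.

Lemma level_continuous m (q : 'I_m.+1 -> bool) : continuous (level q).
Proof.
move=> x; apply: continuous_at_sum => a _.
by apply: continuous_at_coord; exact: simplex_val_continuous.
Qed.

Lemma level_face m (q : 'I_m.+2 -> bool) l (x : std_simplex R m) :
  level q (face l x) = level (q \o lift l) x.
Proof. exact: sum_face_row. Qed.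

Lemma level_true m (x : std_simplex R m) : level xpredT x = 1.
Proof. by have /set_mem[_] := valP x. Qed.

Lemma level_false m (x : std_simplex R m) : level xpred0 x = 0.
Proof. exact: big_pred0. Qed.

End PushForward.

Section Prism.
Context {R : realType} {X Y : topologicalType} (F : X * R -> Y).
Hypothesis F_cont : continuous F.

Lemma prism_continuous n m (s : simplex R X n) (th : 'I_m.+1 -> 'I_n.+1) (q : 'I_m.+1 -> bool) :
  continuous (fun x : std_simplex R m => F (s (push th x), level q x)).
Proof.
move=> x; apply: (@continuous_comp _ _ _
  (fun x : std_simplex R m => (s (push th x), level q x)) F); last exact: F_cont.
apply: continuous_at_pair; last exact: level_continuous.
by apply: continuous_comp; [exact: push_continuous | exact: cts_fun].
Qed.

(* The affine simplex of [Delta^n * R] whose [a]-th vertex is the [th a]-th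
   vertex of [Delta^n], at height 1 when [q a] and 0 otherwise, mapped to [Y]. *)
Definition prism n m (s : simplex R X n) (th : 'I_m.+1 -> 'I_n.+1) (q : 'I_m.+1 -> bool) :
  simplex R Y m := mkcts (@prism_continuous n m s th q).

Lemma prism_ext n m (s : simplex R X n) (th th' : 'I_m.+1 -> 'I_n.+1) (q q' : 'I_m.+1 -> bool) :
  th =1 th' -> q =1 q' -> prism s th q = prism s th' q'.
Proof. by move=> /funext -> /funext ->. Qed.

Lemma simplex_face_prism n m (s : simplex R X n) (th : 'I_m.+2 -> 'I_n.+1)
    (q : 'I_m.+2 -> bool) l :
  simplex_face (prism s th q) l = prism s (th \o lift l) (q \o lift l).
Proof.
apply/continuousEP => x.
rewrite -[LHS]/(F (s (push th (face l x)), level q (face l x))).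
by rewrite push_face level_face.
Qed.

Lemma prism_simplex_face n m (s : simplex R X n.+1) (th : 'I_m.+1 -> 'I_n.+1)
    (q : 'I_m.+1 -> bool) l :
  prism (simplex_face s l) th q = prism s (lift l \o th) q.
Proof.
apply/continuousEP => x.
by rewrite -[LHS]/(F (s (face l (push th x)), level q x)) face_push.
Qed.

(** The i-th degeneracy, merging the vertices i and i + 1; meaningful for i <= m. *)
Definition degen m (i : nat) (a : 'I_m.+2) : 'I_m.+1 := inord (unbump i a).

Lemma degenE m i (a : 'I_m.+2) : (i <= m)%N -> degen i a = unbump i a :> nat.
Proof. by move=> im; rewrite inordK // /unbump; have := ltn_ord a; lia. Qed.

(** The primitive is [u] composed with the prism operator: its i-th simplex has the vertices 0, ...,
    i at height 0 followed by i, ..., n at height 1. As [u] is a cocycle, summing its coboundary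
    over these simplices gives the identity. *)
Lemma homotopy_coboundary (A : zmodType) n (f0 f1 : continuousType X Y)
    (u : simplex R Y n.+1 -> A) :
  (forall x, F (x, 0) = f0 x) -> (forall x, F (x, 1) = f1 x) ->
  coboundary u = 0 ->
  exists psi : simplex R X n -> A,
    coboundary psi = pullback f1 u - pullback f0 u.
Proof.
move=> F0 F1 u0.
exists (fun s => \sum_(i < n.+1)
  u (prism s (degen i) (fun a => i < a)%N) *~ (-1) ^+ i).
apply/funext => s; rewrite /coboundary.
pose T (j i : nat) : A :=
  u (prism s (lift (inord j : 'I_n.+2) \o degen i) (fun a => i < a)%N).
pose U (i l : nat) : A :=
  u (prism s (degen i \o lift (inord l : 'I_n.+3)) (fun a => i < lift (inord l : 'I_n.+3) a)%N).
(* At [i = 0] every vertex has height 1, which gives [f1]; at [i = n.+2] none does, which gives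
   [f0]. *)
pose D (i : nat) : A := u (prism s id (fun a => i <= a)%N).
have inord3 l : (l < n.+3)%N -> (inord l : 'I_n.+3) = l :> nat by move=> ?; rewrite inordK.
have inord2 l : (l < n.+2)%N -> (inord l : 'I_n.+2) = l :> nat by move=> ?; rewrite inordK.
have : 0 = D 0%N - D n.+2 -
    \sum_(0 <= j < n.+2) \sum_(0 <= i < n.+1) T j i *~ (-1) ^+ (j + i).
  rewrite -(@prism_sum A n.+1 T U D).
  - apply/esym; rewrite big_mkord big1 // => i _; rewrite big_mkord.
    pose phi (v : simplex R Y n.+2 -> A) :=
      v (prism s (degen i) (fun a => i < a)%N) *~ (-1) ^+ i.
    have /(congr1 phi) := u0; rewrite /phi /coboundary /= mul0rz mulrz_suml => e.
    rewrite -[RHS]e; apply: eq_bigr => l _.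
    by rewrite simplex_face_prism -mulrzA exprD mulrC /U inord_val.
  - move=> i l iN li; apply: (congr1 u); apply: prism_ext => a /=; have aN := ltn_ord a.
      apply: val_inj; rewrite /= degenE; last by lia.
      by rewrite /= /bump !inord3 ?inord2 ?degenE /unbump; lia.
    by rewrite /bump !inord3; lia.
  - move=> i iN; apply: (congr1 u); apply: prism_ext => a /=; have aN := ltn_ord a.
      apply: val_inj; rewrite /= degenE; last by lia.
      by rewrite /= /bump /unbump !inord3; lia.
    by rewrite /bump !inord3; lia.
  - move=> i iN; apply: (congr1 u); apply: prism_ext => a /=; have aN := ltn_ord a.
      apply: val_inj; rewrite /= degenE; last by lia.
      by rewrite /= /bump /unbump !inord3; lia.
    by rewrite /bump !inord3; lia.
  - move=> i l iN il lN; apply: (congr1 u); apply: prism_ext => a /=; have aN := ltn_ord a.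
      apply: val_inj; rewrite /= degenE; last by lia.
      by rewrite /= /bump !inord3 ?inord2 ?degenE /unbump; lia.
    by rewrite /bump !inord3; lia.
move=> /esym/eqP; rewrite subr_eq0 => /eqP DE.
transitivity (D 0%N - D n.+2).
  rewrite DE big_mkord; apply: eq_bigr => j _.
  rewrite mulrz_suml big_mkord; apply: eq_bigr => i _.
  by rewrite prism_simplex_face -mulrzA exprD mulrC /T inord_val.
congr (_ - _); apply: (congr1 u); apply/continuousEP => x /=; rewrite /prism /mkcts /= push_id.
  by rewrite (_ : (fun a : 'I_n.+2 => 0 <= a)%N = xpredT) ?level_true ?F1.
rewrite (_ : (fun a : 'I_n.+2 => n.+2 <= a)%N = xpred0) ?level_false ?F0 //.
by apply/funext => a; rewrite leqNgt ltn_ord.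
Qed.

End Prism.

(** * The Euler class *)

Section Bundle.
Context {R : realType} {d k n : nat} {M : manifold R d} (E : vector_bundle M k).

Lemma triv_mapK (t : trivialization k E) p : is_trivialization t -> triv_dom t p ->
  cancel (triv_map t p)^-1%VF (triv_map t p).
Proof.
move=> [_ tP _ _] tp v; have [_ timg] := tP p tp.
by apply: limg_lfunVK; rewrite timg memvf.
Qed.

Lemma total_continuous_at (T : topologicalType) (z : T) (t : trivialization k E)
    (h : T -> M) (x : T -> 'rV[R]_k) (f : forall y, E (h y)) :
  bundle_atlas E t -> triv_dom t (h z) -> continuous_at z h -> continuous_at z x ->
  (\forall y \near z, f y = triv_map t (h y) (x y)) ->
  continuous_at z (fun y => Total (h y) (f y) : Defs.total E).
Proof.
move=> tE tz hc xc fE.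
have [t_open _ t_cont _] := bundle_atlas_triv tE.
have A_open : open (triv_dom t `*` [set: 'rV[R]_k]).
  rewrite openE => y [yt _]; exists (triv_dom t, setT) => //=.
  by split; [exact: open_nbhs_nbhs | exact: filterT].
have tc := @within_open_continuous_at _ _ _ _ (h z, x z) A_open t_cont (conj tz Logic.I).
pose g (w : M * 'rV[R]_k) : Defs.total E := Total w.1 (triv_map t w.1 w.2).
apply: (@continuous_at_near _ _ z (fun y => g (h y, x y))).
  by apply: (@continuous_comp _ _ _ (fun y => (h y, x y)) g) => //; exact: continuous_at_pair.
by apply: filterS fE => y; rewrite /g /= => ->.
Qed.

Variables (g : forall p : M, E p -> E p -> R) (sigma : forall p : M, 'Hom('rV[R]_n, E p)).
Hypothesis g_riem : riemannian_structure g.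
Hypothesis sigma_frame : frame_section sigma.

Let coord_sigma t p (j : 'I_n) : 'rV[R]_k := (triv_map t p)^-1%VF (sigma p (delta_mx 0 j)).

Let coord_sigma_continuous t p j a : bundle_atlas E t -> triv_dom t p ->
  continuous_at p (fun q => coord_sigma t q j 0 a).
Proof.
move=> tE tp; have [_ /(_ t tE j a) ssm] := sigma_frame.
have [t_open _ _ _] := bundle_atlas_triv tE.
exact: smooth_fun_continuous_at t_open ssm tp.
Qed.

(** Over a trivialization, each entry is a polynomial in the coordinates of the frame vectors and
    the coefficients of the metric. *)
Lemma gram_continuous : continuous (fun p => gram (@g p) (sigma p)).
Proof.
move=> p; apply: continuous_at_mx => j l.
have [t tE tp] := bundle_atlas_cover E p.
have tT := bundle_atlas_triv tE; have [t_open _ _ _] := tT.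
have [gP /(_ t tE) g_sm] := g_riem.
pose c q j := coord_sigma t q j.
apply: (@continuous_at_near _ _ p (fun q => \sum_a c q j 0 a * \sum_b c q l 0 b *
    g (tnth (triv_frame t q) a) (tnth (triv_frame t q) b))).
  apply: continuous_at_sum => a _ /=.
  apply: continuous_atM; first exact: coord_sigma_continuous.
  apply: continuous_at_sum => b _ /=.
  apply: continuous_atM; first exact: coord_sigma_continuous.
  exact: smooth_fun_continuous_at t_open (g_sm a b) tp.
have : \forall q \near p, triv_dom t q by exact: open_nbhs_nbhs.
apply: filterS => q tq; rewrite mxE.
have sE j' : sigma q (delta_mx 0 j') = \sum_a c q j' 0 a *: tnth (triv_frame t q) a.
  rewrite -[LHS](triv_mapK tT tq) -/(coord_sigma t q j') hom_row_sum.
  by apply: eq_bigr => a _; rewrite tnth_mktuple.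
rewrite (sE j) (inner_product_suml (gP q)); apply: eq_bigr => a _; congr (_ * _).
rewrite (inner_productC (gP q)) (sE l) (inner_product_suml (gP q)).
by apply: eq_bigr => b _; rewrite (inner_productC (gP q)).
Qed.

Lemma scaled_section_continuous (v : M -> 'rV[R]_n) : continuous v ->
  continuous (fun z : M * R => Total z.1 (z.2 *: sigma z.1 (v z.1)) : Defs.total E).
Proof.
move=> vc [p s].
have [t tE tp] := bundle_atlas_cover E p.
have tT := bundle_atlas_triv tE; have [t_open _ _ _] := tT.
have fstc : continuous_at (p, s) (@fst M R) by exact: cvg_fst.
apply: (total_continuous_at (t := t)
  (x := fun z : M * R => z.2 *: \sum_j v z.1 0 j *: coord_sigma t z.1 j)) => //.
- apply: continuous_at_scale; first exact: cvg_snd.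
  apply: continuous_at_mx => a b.
  have -> : (fun z : M * R => (\sum_j v z.1 0 j *: coord_sigma t z.1 j) a b) =
      (fun z : M * R => \sum_j v z.1 0 j * coord_sigma t z.1 j 0 b).
    by apply/funext => z; rewrite summxE (ord1 a); apply: eq_bigr => j _; rewrite mxE.
  apply: continuous_at_sum => j _ /=; apply: continuous_atM.
    apply: continuous_at_coord.
    by apply: (@continuous_comp _ _ _ (@fst M R) v) => //; exact: vc.
  apply: (@continuous_comp _ _ _ (@fst M R) (fun q => coord_sigma t q j 0 b)) => //.
  exact: coord_sigma_continuous.
- have : \forall z \near (p, s), triv_dom t z.1.
    by apply: fstc; exact: open_nbhs_nbhs.
  apply: filterS => -[q r] /= tq.
  rewrite linearZ /= linear_sum hom_row_sum; congr (_ *: _); apply: eq_bigr => j _.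
  by rewrite linearZ; congr (_ *: _); exact: esym (triv_mapK tT tq _).
Qed.

End Bundle.

(** The pullback of [u] by the zero section is the coboundary of [- psi]. The rank is a successor
    because [psi] lives one degree lower. *)
Lemma euler_class_trivial (R : realType) (d k : nat) (M : manifold R d)
    (E : vector_bundle M k.+1) (o : forall p : M, set (k.+1.-tuple (E p)))
    (e : set (simplex R M k.+1 -> int)) (s : forall p : M, E p) :
  (forall p, s p != 0) ->
  continuous (fun z : M * R => Total z.1 (z.2 *: s z.1) : Defs.total E) ->
  is_euler_class o e -> e = cohomology_class 0.
Proof.
move=> s0 Fc [u [u_cocycle u_nonzero _] ->].
pose F (z : M * R) : Defs.total E := Total z.1 (z.2 *: s z.1).
have f1c : continuous (fun p : M => F (p, 1)).
  move=> p; apply: (@continuous_comp _ _ _ (fun p : M => (p, 1 : R)) F); last exact: Fc.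
  by apply: continuous_at_pair; [exact: cvg_id | exact: cst_continuous].
have [||psi psiE] := homotopy_coboundary (f0 := zero_section E) (f1 := mkcts f1c) Fc _ _ u_cocycle.
- by move=> p; rewrite /F /= scale0r.
- by [].
have u1 : pullback (mkcts f1c) u = 0.
  apply/funext => t; apply: u_nonzero => x.
  by rewrite /nonzero_vectors /mkcts /F /= scale1r.
rewrite u1 sub0r in psiE.
have cobD phi phi' : coboundary (phi + phi' : simplex R M k -> int) =
    coboundary phi + coboundary phi'.
  apply/funext => t; rewrite -[RHS]/(coboundary phi t + coboundary phi' t).
  by rewrite /coboundary -big_split; apply: eq_bigr => i _; exact: mulrzDl.
have cobN phi : coboundary (- phi : simplex R M k -> int) = - coboundary phi.
  apply/funext => t; rewrite -[RHS]/(- coboundary phi t) /coboundary -sumrN.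
  by apply: eq_bigr => i _; exact: mulNrz.
apply/seteqP; split=> phi [a _ aE].
  by exists (a - psi) => //; rewrite cobD cobN aE psiE opprK subrK subr0.
by exists (a + psi) => //; rewrite cobD aE psiE subr0.
Qed.

Theorem theorem5p6 (R : realType) (d k n : nat) (M : manifold R d)
    (E : vector_bundle M k)
    (o : forall p : M, set (k.-tuple (E p)))
    (g : forall p : M, E p -> E p -> R)
    (sigma : forall p : M, 'Hom('rV[R]_n, E p))
    (e : set (simplex R M k -> int)) :
  connected [set: M] ->
  (k <= n)%N ->
  bundle_orientation o ->
  riemannian_structure g ->
  frame_section sigma ->
  is_euler_class o e ->
  e <> cohomology_class 0 ->
  homology_vanishes R M 'Z_2 1 ->
  forall i : 'I_k, ~ i_generic g sigma i.
Proof.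
move=> _ _ _ g_riem sigma_frame e_euler e0 H1 i generic; apply: e0.
have [gP _] := g_riem; have [sigma_surj _] := sigma_frame.
have /choice[lam lamP] := generic.
have lam_char p : roots_poly (lam p) = char_poly (mxof
    (vbasis (fullv : {vspace E p})) (vbasis (fullv : {vspace E p}))
    (frame_operator (g p) (sigma p))).
  by have [[_ ->] _] := lamP p.
(* The characteristic polynomial has degree the dimension of the fibre, and it has [k] linear
   factors. *)
have dimE p : \dim (fullv : {vspace E p}) = k.
  have := size_roots_poly (lam p).
  by rewrite lam_char size_char_poly => -[].
(* The eigenvalue must be nonzero: the eigenvectors of the Gram matrix for 0 are the vectors killed
   by [sigma p]. *)
have lam0 p : lam p i != 0.
  have := frame_operator_eigen_neq0 (gP p) (sigma_surj p).
  by apply: contra => /eqP <-; rewrite -lam_char rootE root_roots_poly.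
have [P [Plf Peig]] : exists P : M -> 'M[R]_n, line_field P /\
    forall p (v : 'rV[R]_n), v *m P p = v ->
      v *m gram (g p) (sigma p) = lam p i *: v.
  apply: (@eigen_line_field _ _ _ _ n k).
  - exact: gram_continuous.
  - by move=> p; have [[]] := lamP p.
  - by move=> p; rewrite lam_char char_poly_frame_operator // dimE.
  - exact: lam0.
  - move=> p j lji; have [_ /eqP] := lamP p; rewrite /multiplicity eqn_leq => /andP[+ _].
    by move=> /card_le1_eqP; apply; apply/mem_set; rewrite /= ?lji eqxx.
have [v [vc vP]] := line_field_global_section Plf
  (@manifold_locally_path_connected _ _ M) H1.
have s0 p : sigma p (v p) != 0.
  have [v0 vPp] := vP p.
  exact: (gram_eigen_neq0 (gP p) (Peig _ _ vPp) (lam0 p) v0).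
have Fc := scaled_section_continuous sigma_frame vc.
destruct k as [|k']; first by have := ltn_ord i.
exact: euler_class_trivial s0 Fc e_euler.
Qed.
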